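(* Let $n=2$ and let $A=(A_1,A_2)$ be a generic pair of real $3\times4$ matrices (i.e. $A$ lies in the complement of a certain proper algebraic subvariety of the space of pairs of $3\times 4$ matrices). Then the rigid multiview ideal $J_A$ is minimally generated by eleven $\mathbb{Z}^4$-homogeneous polynomials in twelve variables: one of degree $(1,1,0,0)$, one of degree $(0,0,1,1)$, and nine of degree $(2,2,2,2)$.
   Context: Let $$Q(X,Y)=(X_0Y_3-Y_0X_3)^2+(X_1Y_3-Y_1X_3)^2+(X_2Y_3-Y_2X_3)^2-X_3^2Y_3^2,$$ defining a hypersurface $V(Q)\subset\mathbb{P}^3\times\mathbb{P}^3$. For two cameras $A_1,A_2\in\mathbb{R}^{3\times4}$ of rank $3$, the rigid multiview variety is the Zariski closure of the image of the rational map $V(Q)\dashrightarrow(\mathbb{P}^2)^2\times(\mathbb{P}^2)^2$, $(X,Y)\mapsto\bigl((A_1X,A_2X),(A_1Y,A_2Y)\bigr)$. The rigid multiview ideal $J_A$ is its multihomogeneous prime ideal in the polynomial ring $\mathbb{R}[u,v]$ in the $12$ variables $u_{i0},u_{i1},u_{i2},v_{i0},v_{i1},v_{i2}$, $i=1,2$, where $(u_{i0}:u_{i1}:u_{i2})$ and $(v_{i0}:v_{i1}:v_{i2})$ are coordinates on the $i$-th factor on the left, respectively right. The ring is $\mathbb{Z}^4$-graded: $u_{1*}$ has degree $(1,0,0,0)$, $u_{2*}$ has degree $(0,1,0,0)$, $v_{1*}$ has degree $(0,0,1,0)$, $v_{2*}$ has degree $(0,0,0,1)$. *)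

(* Defs.v *)
From HB Require Import structures.
From mathcomp Require Import all_boot all_order all_algebra.
From mathcomp Require Import mpoly complex reals.

Set Implicit Arguments.
Unset Strict Implicit.
Unset Printing Implicit Defensive.

Import GRing.Theory.
Local Open Scope ring_scope.

(* The polynomial ring in the 12 variables of (P^2)^2 x (P^2)^2.  The four
   factors are indexed by 'I_4, in the order u_1, u_2, v_1, v_2, and the
   variable 'X_(mxvec_index f j) is the j-th coordinate on the factor f. *)
Notation viewring K := {mpoly K[4 * 3]}.

Definition multidegree (m : 'X_{1.. 4 * 3}) : 4.-tuple nat :=
  [tuple (\sum_(j < 3) m (mxvec_index f j))%N | f < 4].

(* As usual, 0 is multihomogeneous of every multidegree. *)
Definition multihomogeneous_of_degree (K : fieldType) (d : 4.-tuple nat)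
    (F : viewring K) : Prop :=
  forall m, m \in msupp F -> multidegree m = d.

Definition multihomogeneous (K : fieldType) (F : viewring K) : Prop :=
  exists d, multihomogeneous_of_degree d F.

Definition ideal_generated (n : nat) (K : fieldType) (S : {mpoly K[n]} -> Prop)
    (F : {mpoly K[n]}) : Prop :=
  exists k (h g : 'I_k -> {mpoly K[n]}),
    (forall i, S (g i)) /\ F = \sum_(i < k) h i * g i.

(* A family generates I, and no proper subfamily does. *)
Definition minimally_generates (n k : nat) (K : fieldType)
    (g : 'I_k -> {mpoly K[n]}) (I : {mpoly K[n]} -> Prop) : Prop :=
  let generates (D : {set 'I_k}) :=
    forall F, I F <-> ideal_generated (fun G => exists2 i, i \in D & G = g i) F
  in generates [set: 'I_k] /\ forall D, generates D -> D = [set: 'I_k].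

(* A point of (P^2)^4 over K is given by homogeneous coordinates: a 4 x 3
   matrix all of whose rows are nonzero, each row being relevant only up to a
   nonzero scalar.  Sets of points are predicates on such matrices. *)
Definition is_point (K : fieldType) (p : 'M[K]_(4, 3)) : Prop :=
  forall f, row f p != 0.

Definition eval_at (K : fieldType) (F : viewring K) (p : 'M[K]_(4, 3)) : K :=
  F.@[fun k => mxvec p 0 k].

Definition zariski_closure (K : fieldType) (S : 'M[K]_(4, 3) -> Prop)
    (p : 'M[K]_(4, 3)) : Prop :=
  is_point p /\
  forall F : viewring K, multihomogeneous F ->
    (forall q, S q -> eval_at F q = 0) -> eval_at F p = 0.

Definition distance_form (K : fieldType) (X Y : 'cV[K]_4) : K :=
  let x (i : 'I_4) := X i 0 in
  let y (i : 'I_4) := Y i 0 in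
  (x 0 * y 3 - y 0 * x 3) ^+ 2 + (x 1 * y 3 - y 1 * x 3) ^+ 2
  + (x 2 * y 3 - y 2 * x 3) ^+ 2 - x 3 ^+ 2 * y 3 ^+ 2.

Definition in_VQ (K : fieldType) (X Y : 'cV[K]_4) : Prop :=
  [/\ X != 0, Y != 0 & distance_form X Y = 0].

(* The rational map is undefined at (X, Y) when one of the four vectors
   A_i X, A_i Y vanishes; c accounts for the choice of representatives. *)
Definition rigid_image (K : fieldType) (A1 A2 : 'M[K]_(3, 4))
    (p : 'M[K]_(4, 3)) : Prop :=
  exists X Y : 'cV[K]_4, exists c : 'I_4 -> K,
    let views := [tuple A1 *m X; A2 *m X; A1 *m Y; A2 *m Y] in
    [/\ in_VQ X Y,
        forall f, tnth views f != 0,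
        forall f, c f != 0 &
        forall f, row f p = c f *: (tnth views f)^T].

Definition rigid_multiview_variety (K : fieldType) (A1 A2 : 'M[K]_(3, 4)) :
    'M[K]_(4, 3) -> Prop :=
  zariski_closure (rigid_image A1 A2).

(* The cameras and the polynomials of the ideal are real, whereas varieties
   are sets of complex points. *)
Definition rigid_multiview_ideal (R : realType) (A1 A2 : 'M[R]_(3, 4)) :
    viewring R -> Prop :=
  let toC : R -> R[i]%C := real_complex R in
  ideal_generated (fun F : viewring R =>
    multihomogeneous F /\
    forall p, rigid_multiview_variety (map_mx toC A1) (map_mx toC A2) p ->
      eval_at (map_mpoly toC F) p = 0).

(* P holds on the complement of a proper algebraic subset of the 24-dimensional
   space of pairs of 3 x 4 matrices. *)
Definition for_generic_pair (K : fieldType)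
    (P : 'M[K]_(3, 4) -> 'M[K]_(3, 4) -> Prop) : Prop :=
  exists s : seq {mpoly K[(3 + 3) * 4]},
    let V (A1 A2 : 'M[K]_(3, 4)) :=
      forall f, f \in s -> f.@[fun k => mxvec (col_mx A1 A2) 0 k] = 0 in
    (exists A1 A2, ~ V A1 A2) /\ forall A1 A2, ~ V A1 A2 -> P A1 A2.

(* Main.v *)
Require Import Defs.
From HB Require Import structures.
From mathcomp Require Import all_boot all_order all_algebra.
From mathcomp Require Import ssrcomplements mpoly complex reals.
From mathcomp Require Import ring zify.

(* Choose coordinates in which the two cameras are (x0, x1, x2, x3) |->
   (x0, x1, x2) and (x0, x1, x3).  Pairs of views of a point are then
   parametrized by (sa, sb, z), (ta, tb, w), coming from the world point
   X = (sta, stb, tz, sw), and the polynomials in the views become the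
   polynomials in a, b, z, s, t, w all of whose monomials have the same degree in
   (a, b) as in (s, t); the kernel is generated by the epipolar form.  A form F vanishes on
   the rigid variety iff Q(X, Y), which has excess deg_{a,b} - deg_{s,t} = -2,
   divides the image of F, and likewise for the parameters c, d, ... of Y.
   Hence the cofactor has excess 2 in both groups, so it is a combination of
   products of {a^2, ab, b^2} and {c^2, cd, d^2} with images of polynomials:
   this gives the nine octics, which are independent because these products
   are.  Divisibility by Q is first proved in the world coordinates X, Y, and
   carried over by cancelling monomials not dividing Q. *)

Set Implicit Arguments.
Unset Strict Implicit.
Unset Printing Implicit Defensive.

Import Order.TTheory GRing.Theory Num.Theory.
Local Open Scope ring_scope.

(** * Polynomials over infinite domains *)

Lemma mpoly_ring_ind n (K : comNzRingType) (P : {mpoly K[n]} -> Prop) :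
  (forall c, P c%:MP) -> (forall i, P 'X_i) ->
  (forall p q, P p -> P q -> P (p + q)) ->
  (forall p q, P p -> P q -> P (p * q)) -> forall p, P p.
Proof.
move=> PC PX PD PM; elim/mpolyind => [|c m p _ _ Pp]; first by rewrite -mpolyC0.
apply: PD => //; rewrite -mul_mpolyC; apply: (PM) => //; rewrite mpolyXE_id.
have P1 : P 1 by rewrite -mpolyC1.
apply: big_ind => // i _; elim: (m i) => [|k IH]; rewrite ?expr0 // exprS.
exact: PM.
Qed.

Lemma mpoly_rmorph_eq n (K T : comNzRingType)
    (f g : {rmorphism {mpoly K[n]} -> T}) :
  (forall c, f c%:MP = g c%:MP) -> (forall i, f 'X_i = g 'X_i) -> f =1 g.
Proof.
move=> eqC eqX; apply: mpoly_ring_ind => // p q eqp eqq.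
  by rewrite !rmorphD eqp eqq.
by rewrite !rmorphM eqp eqq.
Qed.

Lemma eq_mmap n (K T : comNzRingType) (f : {rmorphism K -> T})
    (h h' : 'I_n -> T) : h =1 h' -> mmap f h =1 mmap f h'.
Proof.
move=> eqh; apply: mpoly_rmorph_eq => [c|i]; first by rewrite /= !mmapC.
by rewrite /= !mmapX !mmap1U.
Qed.

Lemma rmorph_mmap n (K T U : comNzRingType) (f : {rmorphism K -> T})
    (f' : {rmorphism K -> U}) (g : {rmorphism T -> U}) (h : 'I_n -> T) p :
  (forall c, g (f c) = f' c) ->
  g (mmap f h p) = mmap f' (fun i => g (h i)) p.
Proof.
move=> eqc; pose g1 : {rmorphism {mpoly K[n]} -> U} := g \o mmap f h.
pose g2 : {rmorphism {mpoly K[n]} -> U} := mmap f' (fun i => g (h i)).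
apply: (mpoly_rmorph_eq (f := g1) (g := g2)) => [c|i].
  by rewrite /= !mmapC eqc.
by rewrite /= !mmapX !mmap1U.
Qed.

Lemma mmap_id n (K : comNzRingType) (p : {mpoly K[n]}) :
  mmap (@mpolyC n K) (fun i => 'X_i) p = p.
Proof.
pose g2 : {rmorphism {mpoly K[n]} -> _} := @idfun {mpoly K[n]}.
apply: (mpoly_rmorph_eq (f := mmap (@mpolyC n K) (fun i => 'X_i)) (g := g2)) => [c|i].
  by rewrite /= mmapC.
by rewrite /= mmapX mmap1U.
Qed.

Lemma poly_eq0_horner (K : numDomainType) (p : {poly K}) :
  (forall t, p.[t] = 0) -> p = 0.
Proof.
move=> p0; apply: (@roots_geq_poly_eq0 _ p [seq k%:R | k <- iota 0 (size p)]).
- by apply/allP => t _; apply/rootP.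
- by rewrite map_inj_uniq ?iota_uniq // => i j /eqP; rewrite eqr_nat => /eqP.
- by rewrite size_map size_iota.
Qed.

Lemma mpoly_eq0_meval (K : numDomainType) n (p : {mpoly K[n]}) :
  (forall v, p.@[v] = 0) -> p = 0.
Proof.
elim: n p => [|n IHn] p p0.
  have Ep : p = (p@_0)%:MP.
    apply/mpolyP => m; have -> : m = 0%MM by apply/mnmP => -[].
    by rewrite mcoeffC eqxx mulr1.
  by have := p0 (fun=> 0); rewrite Ep mevalC => ->; rewrite mpolyC0.
(* The last variable becomes the indeterminate of a univariate polynomial over the first [n]; [back]
   inverts this, so it suffices that [uni p] vanishes, which is tested coefficient by
   coefficient. *)
pose hX (i : 'I_n.+1) : {poly {mpoly K[n]}} :=
  if unlift ord_max i is Some j then ('X_j)%:P else 'X.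
pose uni : {rmorphism {mpoly K[n.+1]} -> {poly {mpoly K[n]}}} :=
  mmap (polyC \o @mpolyC n K) hX.
pose wid : {rmorphism {mpoly K[n]} -> {mpoly K[n.+1]}} :=
  mmap (@mpolyC n.+1 K) (fun j => 'X_(lift ord_max j)).
pose back : {rmorphism {poly {mpoly K[n]}} -> {mpoly K[n.+1]}} :=
  horner_eval 'X_(ord_max) \o map_poly wid.
pose backuni : {rmorphism {mpoly K[n.+1]} -> {mpoly K[n.+1]}} := back \o uni.
pose idm : {rmorphism {mpoly K[n.+1]} -> {mpoly K[n.+1]}} := @idfun {mpoly K[n.+1]}.
have backuniE : backuni =1 idm.
  apply: mpoly_rmorph_eq => [c|i] /=; rewrite /horner_eval.
    by rewrite mmapC /= map_polyC hornerC /= mmapC.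
  rewrite mmapX mmap1U /hX; case: unliftP => [j ->|->] /=.
    by rewrite map_polyC hornerC /= mmapX mmap1U.
  by rewrite map_polyX hornerX.
suff uni0 : uni p = 0.
  have <- : back (uni p) = p := backuniE p.
  by rewrite uni0 rmorph0.
apply/polyP => k; rewrite coef0; apply: IHn => w.
suff E : map_poly (meval w) (uni p) = 0.
  by have := congr1 (fun q : {poly K} => q`_k) E; rewrite coef_map coef0.
apply: poly_eq0_horner => t.
pose v (i : 'I_n.+1) := if unlift ord_max i is Some j then w j else t.
pose ev : {rmorphism {mpoly K[n.+1]} -> K} :=
  horner_eval t \o (map_poly (meval w) \o uni).
have : ev =1 meval v.
  apply: mpoly_rmorph_eq => [c|i] /=; rewrite /horner_eval.
    by rewrite mmapC /= map_polyC hornerC /= !mevalC.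
  rewrite mmapX mmap1U /hX mevalXU /v; case: unliftP => [j _|_] /=.
    by rewrite map_polyC hornerC /= mevalXU.
  by rewrite map_polyX hornerX.
by move/(_ p); rewrite p0.
Qed.

Section SetVarZero.
Variables (n : nat) (K : idomainType) (i : 'I_n).

Definition kill_var : {mpoly K[n]} -> {mpoly K[n]} :=
  mmap (@mpolyC n K) (fun j => if j == i then 0 else 'X_j).

HB.instance Definition _ := GRing.RMorphism.on kill_var.

Lemma kill_varE p : exists q, p = kill_var p + 'X_i * q.
Proof.
elim/mpoly_ring_ind: p => [c|j|p q [p' Ep] [q' Eq]|p q [p' Ep] [q' Eq]].
- by exists 0; rewrite /kill_var mmapC mulr0 addr0.
- rewrite /kill_var mmapX mmap1U; case: eqP => [->|_].
    by exists 1; rewrite add0r mulr1.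
  by exists 0; rewrite mulr0 addr0.
- by exists (p' + q'); rewrite {1}Ep {1}Eq rmorphD mulrDr addrACA.
- exists (kill_var p * q' + p' * kill_var q + 'X_i * p' * q').
  by rewrite {1}Ep {1}Eq rmorphM; ring.
Qed.

(** The variable is prime and, by the first hypothesis, does not divide [W]; each of its powers on
    the left must therefore divide the cofactor [g]. *)
Lemma cancel_var_dvd (W p g : {mpoly K[n]}) N :
  kill_var W != 0 -> 'X_i ^+ N * p = W * g -> exists g', p = W * g'.
Proof.
move=> W0; elim: N g => [|N IHN] g; first by rewrite expr0 mul1r; exists g.
have [q Eg] := kill_varE g => Epg.
have kX : kill_var 'X_i = 0 by rewrite /kill_var mmapX mmap1U eqxx.
have : kill_var W * kill_var g = 0.
  by rewrite -rmorphM -Epg rmorphM rmorphXn /= kX expr0n mul0r.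
move/eqP; rewrite mulf_eq0 (negbTE W0) => /eqP g0.
apply: (IHN q); have X0 : 'X_i != 0 :> {mpoly K[n]}.
  by apply/eqP => /(congr1 (mcoeff U_(i))); rewrite mcoeffX eqxx mcoeff0; apply/eqP/oner_neq0.
apply: (mulfI X0); rewrite mulrA -exprS Epg [in LHS]Eg g0 add0r.
by rewrite mulrCA.
Qed.

End SetVarZero.

(** * Divisibility by the distance form *)

(** A quadrilinear form with the distance form on its diagonal. It allows different multiples of the
    same world point to be inserted in each of the four slots. *)
Definition polar_distance (T : comNzRingType) (X X' Y Y' : 'cV[T]_4) : T :=
  let d (X Y : 'cV[T]_4) i := X i 0 * Y 3 0 - Y i 0 * X 3 0 in
  d X Y 0 * d X' Y' 0 + d X Y 1 * d X' Y' 1 + d X Y 2 * d X' Y' 2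
  - X 3 0 * X' 3 0 * (Y 3 0 * Y' 3 0).

Lemma polar_distance_diag (K : fieldType) (X Y : 'cV[K]_4) :
  polar_distance X X Y Y = distance_form X Y.
Proof. by rewrite /polar_distance /distance_form; ring. Qed.

Lemma polar_distanceZ (T : comNzRingType) (a a' b b' : T)
    (X X' Y Y' : 'cV[T]_4) :
  polar_distance (a *: X) (a' *: X') (b *: Y) (b' *: Y')
  = a * a' * (b * b') * polar_distance X X' Y Y'.
Proof. by rewrite /polar_distance !mxE; ring. Qed.

Lemma rmorph_polar_distance (T U : comNzRingType) (f : {rmorphism T -> U})
    (X X' Y Y' : 'cV[T]_4) :
  f (polar_distance X X' Y Y')
  = polar_distance (map_mx f X) (map_mx f X') (map_mx f Y) (map_mx f Y').
Proof. by rewrite /polar_distance !mxE !(rmorphB, rmorphD, rmorphM). Qed.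

Lemma mmap_kill_var n (K : idomainType) (T : comNzRingType)
    (f : {rmorphism K -> T}) (h : 'I_n -> T) i p :
  mmap f h (kill_var i p) = mmap f (fun j => if j == i then 0 else h j) p.
Proof.
rewrite /kill_var (rmorph_mmap (f' := f)) => [|c]; last by rewrite /= mmapC.
by apply: eq_mmap => j; case: eqP => _; rewrite ?rmorph0 //= mmapX mmap1U.
Qed.

Section DistanceDivides.
Variable R : realType.
Let X : 'cV[{mpoly R[4 + 4]}]_4 := \col_i 'X_(lshift 4 i).
Let Y : 'cV[{mpoly R[4 + 4]}]_4 := \col_i 'X_(rshift 4 i).
Let Q := polar_distance X X Y Y.
Let toC : {rmorphism R -> R[i]%C} := real_complex R.
Let i0 : 'I_(4 + 4) := lshift 4 0.
Let xi := X 0 0 * Y 3 0 - Y 0 0 * X 3 0.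
Let D := (X 3 0 * Y 3 0) ^+ 2 - (X 1 0 * Y 3 0 - Y 1 0 * X 3 0) ^+ 2
  - (X 2 0 * Y 3 0 - Y 2 0 * X 3 0) ^+ 2.

Let killX j : kill_var i0 'X_j = if j == i0 then 0 else 'X_j :> {mpoly R[4 + 4]}.
Proof. by rewrite /kill_var mmapX mmap1U. Qed.

Let killXi j : j != 0 -> kill_var i0 (X j 0) = X j 0.
Proof. by move=> j0; rewrite mxE killX eq_lshift (negbTE j0). Qed.

Let killYi j : kill_var i0 (Y j 0) = Y j 0.
Proof. by rewrite mxE killX eq_rlshift. Qed.

Let killD : kill_var i0 D = D.
Proof.
by rewrite /D !(rmorphB, rmorphXn, rmorphM) /= !killXi // !killYi.
Qed.

Let QE : Q = xi ^+ 2 - D.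
Proof. by rewrite /Q /polar_distance /xi /D; ring. Qed.

(* Division by Q as a monic quadratic polynomial in xi, which is, up to the
   factor Y_3, an affine coordinate replacing X_0. *)
Lemma distance_pseudo_division p :
  exists N G a b, (Y 3 0) ^+ N * p = Q * G + kill_var i0 a + kill_var i0 b * xi.
Proof.
move: D killD QE => d killd QEd.
elim/mpoly_ring_ind: p => [c|j|p q [N [G [a [b E]]]] [N' [G' [a' [b' E']]]]
  |p q [N [G [a [b E]]]] [N' [G' [a' [b' E']]]]].
- exists 0%N, 0, c%:MP, 0; rewrite /kill_var mmapC rmorph0; ring.
- case: (eqVneq j i0) => [->|ji0].
    (* This is the identity Y_3 X_0 = Y_0 X_3 + xi. *)
    exists 1%N, 0, (Y 0 0 * X 3 0), 1; rewrite rmorphM rmorph1 /= killXi // killYi.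
    by rewrite /xi [X 0 0]mxE; ring.
  exists 0%N, 0, 'X_j, 0; rewrite killX (negbTE ji0) rmorph0; ring.
- exists (N + N')%N, (Y 3 0 ^+ N' * G + Y 3 0 ^+ N * G'),
    (Y 3 0 ^+ N' * a + Y 3 0 ^+ N * a'), (Y 3 0 ^+ N' * b + Y 3 0 ^+ N * b').
  rewrite !(rmorphD, rmorphM, rmorphXn) /= killYi exprD.
  transitivity (Y 3 0 ^+ N' * (Y 3 0 ^+ N * p) + Y 3 0 ^+ N * (Y 3 0 ^+ N' * q)); first ring.
  by rewrite E E'; ring.
(* The product of the two remainders contains xi^2, which is replaced by Q + D. *)
- exists (N + N')%N,
    (G * (Y 3 0 ^+ N' * q) + (kill_var i0 a + kill_var i0 b * xi) * G'
     + kill_var i0 b * kill_var i0 b'),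
    (a * a' + b * b' * d), (a * b' + a' * b).
  rewrite !(rmorphD, rmorphM, rmorphXn) /= killd exprD.
  transitivity ((Y 3 0 ^+ N * p) * (Y 3 0 ^+ N' * q)); first ring.
  by rewrite E E' QEd; ring.
Qed.

(** An explicit Nullstellensatz for Q. At a point with y_3 nonzero, X_0 can be chosen so that xi is
    either square root of D. The remainder a + b xi then vanishes for both signs, which forces a = 0
    and b D = 0. Complex points are essential, because D takes negative values at real ones. *)
Lemma distance_dvd (p : {mpoly R[4 + 4]}) :
  (forall X Y : 'cV[R[i]%C]_4, polar_distance X X Y Y = 0 ->
     mmap toC (fun k => col_mx X Y k 0) p = 0) ->
  exists G, p = Q * G.
Proof.
move=> p0; have [N [G [a [b E]]]] := distance_pseudo_division p.
have Y3 : Y 3 0 = 'X_(rshift 4 3) by rewrite mxE.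
have vanish v : v (rshift 4 3) != 0 ->
    (kill_var i0 a).@[v] = 0 /\ (kill_var i0 b * D).@[v] = 0.
  move=> y30; set al := (kill_var i0 a).@[v]; set be := (kill_var i0 b).@[v].
  pose dl := sqrtc (toC D.@[v]).
  have dl2 : dl ^+ 2 = toC D.@[v] by apply: sqr_sqrtc.
  have root e : e ^+ 2 = toC D.@[v] -> toC al + toC be * e = 0.
    move=> e2.
    (* The solution of xi = e for X_0. Since [a], [b] and D are free of X_0 after [kill_var], their
       values are not affected. *)
    pose x0 := (e + toC (v (rshift 4 0)) * toC (v (lshift 4 3)))
       / toC (v (rshift 4 3)).
    pose z k := if k == i0 then x0 else toC (v k).
    pose Z : {rmorphism {mpoly R[4 + 4]} -> R[i]%C} := mmap toC z.
    have ZX j : j != 0 -> Z (X j 0) = toC (v (lshift 4 j)).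
      by move=> j0; rewrite mxE /Z /= mmapX mmap1U /z eq_lshift (negbTE j0).
    have ZY j : Z (Y j 0) = toC (v (rshift 4 j)).
      by rewrite mxE /Z /= mmapX mmap1U /z eq_rlshift.
    have ZX0 : Z (X 0 0) = x0 by rewrite mxE /Z /= mmapX mmap1U /z eqxx.
    have Zkill q : Z (kill_var i0 q) = toC (kill_var i0 q).@[v].
      rewrite /Z /= mmap_kill_var [in RHS]/meval (rmorph_mmap (f' := toC)) //.
      rewrite mmap_kill_var; apply: eq_mmap => k.
      by rewrite /z; case: (k == i0).
    have Zxi : Z xi = e.
      rewrite /xi rmorphB !rmorphM /= ZX0 ZX // !ZY /x0.
      rewrite divfK ?addrK // fmorph_eq0 //.
    have ZQ : Z Q = 0.
      by rewrite QE rmorphB rmorphXn /= Zxi e2 -killD Zkill subrr.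
    have Zp : Z p = 0.
      have := p0 (\col_i z (lshift 4 i)) (\col_i z (rshift 4 i)).
      rewrite (_ : polar_distance _ _ _ _ = Z Q) => [/(_ ZQ)|]; last first.
        rewrite [Q](_ : _ = polar_distance X X Y Y) // [RHS]rmorph_polar_distance.
        by congr polar_distance; apply/matrixP => i j; rewrite !mxE /Z /= mmapX mmap1U.
      move=> <-; apply: eq_mmap => k; case: (split_ordP k) => i ->.
        by rewrite col_mxEu mxE.
      by rewrite col_mxEd mxE.
    move: E ZQ Zxi; generalize Q xi => q x E Zq Zx.
    have := congr1 Z E.
    rewrite !(rmorphD, rmorphM) /= -!/(Z _) Zp Zq !Zkill Zx mulr0 mul0r add0r.
    by move=> <-.
  have r1 := root _ dl2; have r2 : toC al + toC be * (- dl) = 0.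
    by apply: root; rewrite sqrrN.
  have be_dl : toC be * dl = 0.
    have : (toC be * dl) *+ 2 = 0.
      transitivity ((toC al + toC be * dl) - (toC al + toC be * (- dl))); first ring.
      by rewrite r1 r2 subrr.
    by move/eqP; rewrite mulrn_eq0 /= => /eqP.
  split; apply: (fmorph_inj toC); rewrite rmorph0.
    by move: r1; rewrite be_dl addr0.
  by rewrite mevalM rmorphM /= -dl2 expr2 mulrA be_dl mul0r.
(* Multiplying by Y_3 also covers the points with y_3 = 0. *)
have mul0 (q : {mpoly R[4 + 4]}) : (forall v, v (rshift 4 3) != 0 -> q.@[v] = 0) -> q = 0.
  move=> q0; have : q * Y 3 0 = 0.
    apply: mpoly_eq0_meval => v; rewrite mevalM Y3 mevalXU.
    by case: (eqVneq (v (rshift 4 3)) 0) => [->|/q0->]; rewrite ?mulr0 ?mul0r.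
  move/eqP; rewrite mulf_eq0 Y3 => /orP[/eqP //|/eqP/(congr1 (meval (fun=> 1)))].
  by rewrite mevalXU meval0 => /eqP; rewrite oner_eq0.
have a0 : kill_var i0 a = 0 by apply: mul0 => v /vanish[].
have b0 : kill_var i0 b = 0.
  have : kill_var i0 b * D = 0 by apply: mul0 => v /vanish[].
  move/eqP; rewrite mulf_eq0 => /orP[/eqP //|/eqP].
  (* At x_3 = y_3 = 1 and all other coordinates 0, the value of D is 1. *)
  pose v (k : 'I_(4 + 4)) : R := ((k == lshift 4 3) || (k == rshift 4 3))%:R.
  move/(congr1 (meval v)); rewrite /D !(mevalB, mevalM, rmorphXn) /= !mxE !mevalXU.
  rewrite /v !eq_lshift !eq_rshift !eq_rlshift !eq_lrshift /= meval0.
  by rewrite !(mul0r, mulr0, mul1r, subr0, expr0n, expr1n) => /eqP; rewrite oner_eq0.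
move: E; rewrite a0 b0 mul0r !addr0 Y3; apply: cancel_var_dvd.
(* At x_3 = y_0 = 1 and all other coordinates 0, the value of Q is 1 although y_3 = 0; hence Y_3
   does not divide Q. *)
pose v (k : 'I_(4 + 4)) : R := ((k == lshift 4 3) || (k == rshift 4 0))%:R.
apply/eqP => /(congr1 (meval v)); rewrite /meval mmap_kill_var mmap0.
rewrite rmorph_polar_distance /polar_distance !mxE /= !mmapX !mmap1U.
rewrite /v !eq_lshift !eq_rshift !eq_rlshift !eq_lrshift /=.
by move/eqP; rewrite !(mul0r, mulr0, mul1r, subr0, sub0r, expr0n, mulrNN, addr0, oner_eq0).
Qed.

End DistanceDivides.

(** * Ideals and gradings *)

Section IdealGenerated.
Variables (n : nat) (K : fieldType).
Implicit Types (S : {mpoly K[n]} -> Prop) (F G : {mpoly K[n]}).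

Lemma ideal_mem S F : S F -> ideal_generated S F.
Proof.
move=> SF; exists 1%N, (fun=> 1), (fun=> F); split => //.
by rewrite big_ord1 mul1r.
Qed.

Lemma ideal0 S : ideal_generated S 0.
Proof. by exists 0%N, (fun=> 0), (fun=> 0); split=> [[]//|]; rewrite big_ord0. Qed.

Lemma idealD S F G :
  ideal_generated S F -> ideal_generated S G -> ideal_generated S (F + G).
Proof.
move=> [k [h [g [Sg ->]]]] [k' [h' [g' [Sg' ->]]]].
pose glue (u : 'I_k -> {mpoly K[n]}) (u' : 'I_k' -> {mpoly K[n]}) i :=
  match split i with inl j => u j | inr j => u' j end.
exists (k + k')%N, (glue h h'), (glue g g'); split=> [i|].
  by rewrite /glue; case: (split i).
rewrite big_split_ord /glue; congr (_ + _); apply: eq_bigr => i _.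
  by rewrite (unsplitK (inl i)).
by rewrite (unsplitK (inr i)).
Qed.

Lemma idealMl S F G : ideal_generated S F -> ideal_generated S (G * F).
Proof.
move=> [k [h [g [Sg ->]]]]; exists k, (fun i => G * h i), g; split => //.
by rewrite mulr_sumr; apply: eq_bigr => i _; rewrite mulrA.
Qed.

Lemma ideal_sum S (I : Type) (r : seq I) (P : pred I) (F : I -> {mpoly K[n]}) :
  (forall i, P i -> ideal_generated S (F i)) ->
  ideal_generated S (\sum_(i <- r | P i) F i).
Proof. by move=> SF; apply: big_ind => //; [apply: ideal0|apply: idealD]. Qed.

End IdealGenerated.

Lemma ideal_rmorph n n' (K : fieldType) (f : {rmorphism {mpoly K[n]} -> {mpoly K[n']}})
    (S : {mpoly K[n]} -> Prop) (S' : {mpoly K[n']} -> Prop) F :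
  (forall g, S g -> ideal_generated S' (f g)) ->
  ideal_generated S F -> ideal_generated S' (f F).
Proof.
move=> SS' [k [h [g [Sg ->]]]]; rewrite rmorph_sum; apply: ideal_sum => i _.
by rewrite rmorphM; apply/idealMl/SS'.
Qed.

Lemma ideal_sub n (K : fieldType) (S S' : {mpoly K[n]} -> Prop) F :
  (forall g, S g -> ideal_generated S' g) ->
  ideal_generated S F -> ideal_generated S' F.
Proof.
exact: (@ideal_rmorph n n K (@idfun {mpoly K[n]})).
Qed.

Lemma big_mxvec_index (T : Type) (idx : T) (op : Monoid.com_law idx) m n
    (F : 'I_(m * n) -> T) :
  \big[op/idx]_k F k = \big[op/idx]_(i < m) \big[op/idx]_(j < n) F (mxvec_index i j).
Proof.
rewrite pair_bigA /= (reindex (uncurry (@mxvec_index m n))) /=.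
  by apply: eq_bigr => -[i j].
exact: curry_mxvec_bij.
Qed.

Lemma mxvec_index_eq m n (i i' : 'I_m) (j j' : 'I_n) :
  (mxvec_index i j == mxvec_index i' j') = (i == i') && (j == j').
Proof.
apply/eqP/andP => [E|[/eqP-> /eqP->] //].
pose A := \matrix_(i, j) (i, j) : 'M_(m, n).
by have := mxvecE A i j; rewrite E mxvecE !mxE => -[-> ->].
Qed.

Definition mx_eval (K T : comNzRingType) (f : {rmorphism K -> T})
    (p : 'M[T]_(4, 3)) : {mpoly K[4 * 3]} -> T :=
  mmap f (fun k => mxvec p 0 k).

HB.instance Definition _ (K T : comNzRingType) (f : {rmorphism K -> T}) p :=
  GRing.RMorphism.on (mx_eval f p).

Section MxEval.
Variables (K T : comNzRingType) (f : {rmorphism K -> T}).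

Lemma mx_evalC p c : mx_eval f p c%:MP = f c.
Proof. exact: mmapC. Qed.

Lemma mx_evalX p i j : mx_eval f p 'X_(mxvec_index i j) = p i j.
Proof. by rewrite /mx_eval mmapX mmap1U mxvecE. Qed.

Lemma rmorph_mx_eval (U : comNzRingType) (f' : {rmorphism K -> U})
    (g : {rmorphism T -> U}) (p : 'M[T]_(4, 3)) F :
  (forall c, g (f c) = f' c) ->
  g (mx_eval f p F) = mx_eval f' (map_mx g p) F.
Proof.
move=> E; rewrite /mx_eval (rmorph_mmap (f' := f')) //.
by apply: eq_mmap => k; case: (mxvec_indexP k) => i j; rewrite !mxvecE mxE.
Qed.

End MxEval.

Lemma mx_eval_comp (K T : comNzRingType) (f : {rmorphism K -> T})
    (q : 'M[{mpoly K[4 * 3]}]_(4, 3)) (p : 'M[T]_(4, 3)) F :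
  mx_eval f p (mx_eval (@mpolyC _ K) q F) = mx_eval f (map_mx (mx_eval f p) q) F.
Proof. by apply: rmorph_mx_eval => c; exact: mx_evalC. Qed.

Lemma eval_at_map (K L : fieldType) (f : {rmorphism K -> L}) F p :
  eval_at (map_mpoly f F) p = mx_eval f p F.
Proof.
rewrite /eval_at /map_mpoly (rmorph_mmap (f' := f)) => [|c]; last exact: mevalC.
by apply: eq_mmap => k; exact: mevalXU.
Qed.

(** Integer weights, possibly negative, serve two gradings at once: the four degrees of the
    multigrading, through [factor_wt], and the excesses, through [excess_wt]. *)
Definition wt (W : 'M[int]_(4, 3)) (m : 'X_{1.. 4 * 3}) : int :=
  \sum_f \sum_j W f j *+ m (mxvec_index f j).

Lemma wtD W m m' : wt W (m + m')%MM = wt W m + wt W m'.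
Proof.
rewrite /wt -big_split; apply: eq_bigr => f _; rewrite -big_split.
by apply: eq_bigr => j _; rewrite mnmDE mulrnDr.
Qed.

Lemma wtU W f j : wt W U_(mxvec_index f j)%MM = W f j.
Proof.
rewrite /wt (bigD1 f) //= (bigD1 j) //= mnm1E eqxx mulr1n !big1 ?addr0 //.
  move=> i /negbTE fi; rewrite big1 // => l _.
  by rewrite mnm1E mxvec_index_eq eq_sym fi mulr0n.
by move=> l /negbTE jl; rewrite mnm1E mxvec_index_eq eqxx eq_sym jl mulr0n.
Qed.

Definition whom (K : comNzRingType) W (d : int) (F : {mpoly K[4 * 3]}) : Prop :=
  forall m, m \in msupp F -> wt W m = d.

Section Whom.
Variables (K : comNzRingType) (W : 'M[int]_(4, 3)).
Implicit Types F G : {mpoly K[4 * 3]}.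

Lemma whom0 d : whom W d (0 : {mpoly K[4 * 3]}).
Proof. by move=> m; rewrite -mpolyC0 msupp0. Qed.

Lemma whomC c : whom W 0 (c%:MP : {mpoly K[4 * 3]}).
Proof.
move=> m; rewrite msuppC; case: ifP => //; rewrite inE => _ /eqP->.
by rewrite /wt big1 // => f _; rewrite big1 // => j _; rewrite mnm0E.
Qed.

Lemma whomX f j : whom W (W f j) ('X_(mxvec_index f j) : {mpoly K[4 * 3]}).
Proof. by move=> m /mem_msuppXP <-; rewrite wtU. Qed.

Lemma whomN d F : whom W d F -> whom W d (- F).
Proof. by move=> WF m; rewrite (perm_mem (msuppN _)) => /WF. Qed.

Lemma whomD d F G : whom W d F -> whom W d G -> whom W d (F + G).
Proof. by move=> WF WG m /msuppD_le; rewrite mem_cat => /orP[/WF|/WG]. Qed.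

Lemma whomB d F G : whom W d F -> whom W d G -> whom W d (F - G).
Proof. by move=> WF WG; apply: whomD => //; apply: whomN. Qed.

Lemma whomM d d' F G : whom W d F -> whom W d' G -> whom W (d + d') (F * G).
Proof.
move=> WF WG m /msuppM_le /allpairsP[[u v] [/= /WF <- /WG <- ->]].
exact: wtD.
Qed.

Lemma whom_sum d (I : Type) (r : seq I) (P : pred I) (F : I -> {mpoly K[4 * 3]}) :
  (forall i, P i -> whom W d (F i)) -> whom W d (\sum_(i <- r | P i) F i).
Proof. by move=> WF; apply: big_ind => //; [apply: whom0|apply: whomD]. Qed.

Lemma whom_lin d m (A : 'M[K]_m) (X : 'cV[{mpoly K[4 * 3]}]_m) :
  (forall i, whom W d (X i 0)) ->
  forall i, whom W d ((map_mx (@mpolyC _ K) A *m X) i 0).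
Proof.
move=> WX i; rewrite mxE; apply: whom_sum => j _; rewrite mxE -[d]add0r.
by apply: whomM; first apply: whomC.
Qed.

Lemma whom_polar_distance d d' (X X' Y Y' : 'cV[{mpoly K[4 * 3]}]_4) :
  (forall i, whom W d (X i 0)) -> (forall i, whom W d (X' i 0)) ->
  (forall i, whom W d' (Y i 0)) -> (forall i, whom W d' (Y' i 0)) ->
  whom W (d + d' + (d + d')) (polar_distance X X' Y Y').
Proof.
move=> WX WX' WY WY'.
have Wd (Z Z' V V' : {mpoly K[4 * 3]}) :
    whom W d Z -> whom W d Z' -> whom W d' V -> whom W d' V' ->
    whom W (d + d') (Z * V' - V * Z').
  move=> WZ WZ' WV WV'; apply: whomB; first exact: whomM.
  by rewrite addrC; apply: whomM.
rewrite /polar_distance /=; apply: whomB.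
  by repeat apply: whomD; apply: whomM; apply: Wd.
rewrite addrACA; apply: whomM; exact: whomM.
Qed.

End Whom.

Definition factor_wt (f0 : 'I_4) : 'M[int]_(4, 3) := \matrix_(f, j) (f == f0)%:R.

Lemma wt_factor f0 m : wt (factor_wt f0) m = (tnth (multidegree m) f0)%:Z.
Proof.
rewrite tnth_mktuple /wt (bigD1 f0) //= [X in _ + X]big1 ?addr0.
  rewrite -!natz natr_sum; apply: eq_bigr => j _.
  by rewrite mxE eqxx.
move=> f /negbTE ff; rewrite big1 // => j _; rewrite mxE ff.
by rewrite mul0rn.
Qed.

Lemma multihomogeneous_of_degreeP (K : fieldType) d (F : viewring K) :
  multihomogeneous_of_degree d F <->
  forall f, whom (factor_wt f) (tnth d f)%:Z F.
Proof.
split=> [hF f m /hF <-|hF m mF]; first exact: wt_factor.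
apply: eq_from_tnth => f.
by have := hF f m mF; rewrite wt_factor => -[].
Qed.

Lemma mx_eval_scale (K : fieldType) (T : comNzRingType) (f : {rmorphism K -> T})
    (c : 'I_4 -> T) (p : 'M[T]_(4, 3)) d F :
  multihomogeneous_of_degree d F ->
  mx_eval f (\matrix_(i, j) (c i * p i j)) F
  = (\prod_i c i ^+ tnth d i) * mx_eval f p F.
Proof.
move=> hF; rewrite /mx_eval /mmap mulr_sumr big_seq [RHS]big_seq.
apply: eq_bigr => m /hF <-; rewrite mulrCA; congr (_ * _).
rewrite /mmap1 !(big_mxvec_index _ (fun k => _ ^+ m k)) -big_split /=.
apply: eq_bigr => i _; rewrite tnth_mktuple -prodrXr -big_split /=.
by apply: eq_bigr => j _; rewrite !mxvecE mxE exprMn.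
Qed.

(** * Generators in normal form *)

Lemma ord3_ind (P : 'I_3 -> Prop) : P 0 -> P 1 -> P 2 -> forall j, P j.
Proof.
by move=> P0 P1 P2 [[|[|[|j]]] lt_j] //; [move: P0|move: P1|move: P2];
   congr P; apply: val_inj.
Qed.

Lemma ord4_ind (P : 'I_4 -> Prop) : P 0 -> P 1 -> P 2 -> P 3 -> forall f, P f.
Proof.
by move=> P0 P1 P2 P3 [[|[|[|[|f]]]] lt_f] //;
   [move: P0|move: P1|move: P2|move: P3]; congr P; apply: val_inj.
Qed.

Lemma big_ord3 (T : Type) (idx : T) (op : Monoid.law idx) (F : 'I_3 -> T) :
  \big[op/idx]_j F j = op (F 0) (op (F 1) (F 2)).
Proof.
rewrite !big_ord_recl big_ord0 Monoid.mulm1.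
by congr (op (F _) (op (F _) (F _))); apply: val_inj.
Qed.

Lemma big_ord4 (T : Type) (idx : T) (op : Monoid.law idx) (F : 'I_4 -> T) :
  \big[op/idx]_f F f = op (F 0) (op (F 1) (op (F 2) (F 3))).
Proof.
rewrite !big_ord_recl big_ord0 Monoid.mulm1.
by congr (op (F _) (op (F _) (op (F _) (F _)))); apply: val_inj.
Qed.

Definition vec4 (T : comNzRingType) (a b c d : T) : 'cV[T]_4 :=
  \col_i nth 0 [:: a; b; c; d] i.

Lemma vec4_entries (T : comNzRingType) (X : 'cV[T]_4) :
  X = vec4 (X 0 0) (X 1 0) (X 2 0) (X 3 0).
Proof. by apply/colP; elim/ord4_ind; rewrite [RHS]mxE. Qed.

Lemma vec4Z (T : comNzRingType) (e a b c d : T) :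
  e *: vec4 a b c d = vec4 (e * a) (e * b) (e * c) (e * d).
Proof. by apply/colP; elim/ord4_ind; rewrite !mxE. Qed.

Lemma map_vec4 (T U : comNzRingType) (f : {rmorphism T -> U}) a b c d :
  map_mx f (vec4 a b c d) = vec4 (f a) (f b) (f c) (f d).
Proof. by apply/colP; elim/ord4_ind; rewrite !mxE. Qed.

(* In normal form the two cameras are (x0, x1, x2, x3) |-> (x0, x1, x2) and
   (x0, x1, x2, x3) |-> (x0, x1, x3).  Then the world point with views x f and
   x g is proportional to triangulation x f g c, for both c = 0 and c = 1. *)
Definition triangulation (T : comNzRingType) (x : 'M[T]_(4, 3)) f g c : 'cV[T]_4 :=
  vec4 (x f 0 * x g c) (x f 1 * x g c) (x f 2 * x g c) (x f c * x g 2).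

(** In normal form both views begin with x0, x1 of the same world point, so these pairs are
    proportional; the determinant is the bilinear form of the fundamental matrix. *)
Definition epipolar (T : comNzRingType) (x : 'M[T]_(4, 3)) f g : T :=
  x f 0 * x g 1 - x f 1 * x g 0.

Definition pick_coord (b : bool) : 'I_3 := if b then 1 else 0.

(* The nine octics are indexed by a pair of multisets {c, c'}, {d, d'} of
   size 2 in {0, 1}, encoded by the base 3 digits of k - 2. *)
Definition rigid_generator (T : comNzRingType) (M : 'M[T]_4) (x : 'M[T]_(4, 3))
    (k : 'I_11) : T :=
  if k == 0%N :> nat then epipolar x 0 1
  else if k == 1%N :> nat then epipolar x 2 3
  else
    let X b := M *m triangulation x 0 1 (pick_coord b) in
    let Y b := M *m triangulation x 2 3 (pick_coord b) in
    let i := ((k - 2) %/ 3)%N in let j := ((k - 2) %% 3)%N in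
    polar_distance (X (0 < i)%N) (X (1 < i)%N) (Y (0 < j)%N) (Y (1 < j)%N).

Lemma rmorph_rigid_generator (T U : comNzRingType) (f : {rmorphism T -> U}) M x k :
  f (rigid_generator M x k) = rigid_generator (map_mx f M) (map_mx f x) k.
Proof.
have E g h : f (epipolar x g h) = epipolar (map_mx f x) g h.
  by rewrite /epipolar rmorphB !rmorphM !mxE.
rewrite /rigid_generator; case: ifP => _ //; case: ifP => _ //.
rewrite rmorph_polar_distance !map_mxM /triangulation !map_vec4 !rmorphM.
by rewrite !mxE.
Qed.

(* Birational parametrization of the views in normal form: with
   y = ((a, b, z), (s, t, w), ...) the first two views are (sa, sb, z) and
   (ta, tb, w), and they come from the world point (sta, stb, tz, sw). *)
Definition view_param (T : comNzRingType) (y : 'M[T]_(4, 3)) : 'M[T]_(4, 3) :=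
  \matrix_(f, j)
    nth 0 (nth [::] [:: [:: y 1 0 * y 0 0; y 1 0 * y 0 1; y 0 2];
                        [:: y 1 1 * y 0 0; y 1 1 * y 0 1; y 1 2];
                        [:: y 3 0 * y 2 0; y 3 0 * y 2 1; y 2 2];
                        [:: y 3 1 * y 2 0; y 3 1 * y 2 1; y 3 2]] f) j.

Definition world_param (T : comNzRingType) (y : 'M[T]_(4, 3)) f g : 'cV[T]_4 :=
  vec4 (y g 0 * y g 1 * y f 0) (y g 0 * y g 1 * y f 1) (y g 1 * y f 2) (y g 0 * y g 2).

(** The matrix [M] leads from normalized world coordinates back to the original ones, in which the
    distance is measured. *)
Definition param_distance (T : comNzRingType) (M : 'M[T]_4) (y : 'M[T]_(4, 3)) : T :=
  let X := M *m world_param y 0 1 in let Y := M *m world_param y 2 3 in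
  polar_distance X X Y Y.

Lemma triangulation_param (T : comNzRingType) (y : 'M[T]_(4, 3)) b :
  triangulation (view_param y) 0 1 (pick_coord b) = y 0 (pick_coord b) *: world_param y 0 1 /\
  triangulation (view_param y) 2 3 (pick_coord b) = y 2 (pick_coord b) *: world_param y 2 3.
Proof.
by rewrite /triangulation /world_param !vec4Z; case: b; rewrite !mxE /=;
   split; congr vec4; ring.
Qed.

Lemma rigid_generator_bilinear (T : comNzRingType) (M : 'M[T]_4) y (k : 'I_11) :
  (k < 2)%N -> rigid_generator M (view_param y) k = 0.
Proof.
rewrite /rigid_generator ltnS leq_eqVlt ltnS leqn0 => /orP[] /eqP -> /=;
by rewrite /epipolar !mxE /=; ring.
Qed.

(** The triangulated points are multiples of [world_param] by one of a, b (respectively c, d). By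
    multilinearity these scalars come out and leave a common factor, the distance. *)
Lemma rigid_generator_octic (T : comNzRingType) (M : 'M[T]_4) y (k : 'I_11) i j :
  (i <= 2)%N -> (j <= 2)%N -> k = (2 + i * 3 + j)%N :> nat ->
  rigid_generator M (view_param y) k =
    y 0 (pick_coord (0 < i)%N) * y 0 (pick_coord (1 < i)%N) *
    (y 2 (pick_coord (0 < j)%N) * y 2 (pick_coord (1 < j)%N)) * param_distance M y.
Proof.
move=> le_i le_j Ek; rewrite /rigid_generator Ek.
case: eqP => [|_]; first by lia.
case: eqP => [|_]; first by lia.
have -> : ((2 + i * 3 + j - 2) %/ 3 = i)%N by lia.
have -> : ((2 + i * 3 + j - 2) %% 3 = j)%N by lia.
have T1 b := (triangulation_param y b).1; have T2 b := (triangulation_param y b).2.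
by rewrite !T1 !T2 -!scalemxAr polar_distanceZ.
Qed.

(** Exponents are listed factor by factor, three for each. The list is read through [mxvec] of a
    table of positions, so that [mxvecE] computes the exponent at any [mxvec_index]. *)
Definition mnm_seq (l : seq nat) : 'X_{1.. 4 * 3} :=
  [multinom nth 0%N l (mxvec (\matrix_(f < 4, j < 3) (f * 3 + j)%N) 0%R k) | k < 4 * 3].

Lemma mnm_seqE l f j : mnm_seq l (mxvec_index f j) = nth 0%N l (f * 3 + j).
Proof. by rewrite mnmE mxvecE mxE. Qed.

Lemma mnm43P (m m' : 'X_{1.. 4 * 3}) :
  (forall f j, m (mxvec_index f j) = m' (mxvec_index f j)) -> m = m'.
Proof. by move=> E; apply/mnmP => k; case: (mxvec_indexP k). Qed.

Lemma mmap1_43 (T : comNzRingType) (h : 'I_(4 * 3) -> T) (m : 'X_{1.. 4 * 3}) :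
  let F f j := h (mxvec_index f j) ^+ m (mxvec_index f j) in
  mmap1 h m =
  F 0 0 * (F 0 1 * F 0 2) * ((F 1 0 * (F 1 1 * F 1 2)) *
  ((F 2 0 * (F 2 1 * F 2 2)) * (F 3 0 * (F 3 1 * F 3 2)))).
Proof.
by rewrite /= /mmap1 (big_mxvec_index _ (fun k => _ ^+ m k)) big_ord4 !big_ord3.
Qed.

Section LinearExtension.
Variables (n n' : nat) (K : comNzRingType) (s : 'X_{1..n} -> {mpoly K[n']}).

Definition mlin (p : {mpoly K[n]}) : {mpoly K[n']} :=
  \sum_(m <- msupp p) p@_m *: s m.

(** A range of summation that does not depend on the support of [p] is what makes linearity a
    termwise check. *)
Lemma mlinE p k : (msize p <= k)%N -> mlin p = \sum_(m : 'X_{1..n < k}) p@_m *: s m.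
Proof.
move=> le_pk; rewrite /mlin (big_mksub 'X_{1..n < k}) ?msupp_uniq //=.
  by rewrite big_rmcond //= => j /memN_msupp_eq0 ->; rewrite scale0r.
by move=> x /msize_mdeg_lt /leq_trans; apply.
Qed.

Lemma mlin_is_linear : linear mlin.
Proof.
move=> a p q; pose k := maxn (msize (a *: p + q)) (maxn (msize p) (msize q)).
rewrite !(@mlinE _ k) ?leq_max ?leqnn ?orbT // scaler_sumr -big_split /=.
by apply: eq_bigr => m _; rewrite mcoeffD mcoeffZ scalerA scalerDl.
Qed.

HB.instance Definition _ := GRing.isLinear.Build K _ _ _ mlin mlin_is_linear.

Lemma mlinX m : mlin 'X_[m] = s m.
Proof. by rewrite /mlin msuppX big_seq1 mcoeffX eqxx scale1r. Qed.

End LinearExtension.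

(** * The ideal of the parametrization *)

(** The action on exponents of the substitution [view_param], which sends monomials to monomials:
    for instance a occurs in the images of u_10 and u_20, and s in those of u_10 and u_11. *)
Definition phi_mnm (m : 'X_{1.. 4 * 3}) : 'X_{1.. 4 * 3} :=
  let e f j := m (mxvec_index f j) in
  mnm_seq [:: e 0%R 0%R + e 1%R 0%R; e 0%R 1%R + e 1%R 1%R; e 0%R 2%R;
              e 0%R 0%R + e 0%R 1%R; e 1%R 0%R + e 1%R 1%R; e 1%R 2%R;
              e 2%R 0%R + e 3%R 0%R; e 2%R 1%R + e 3%R 1%R; e 2%R 2%R;
              e 2%R 0%R + e 2%R 1%R; e 3%R 0%R + e 3%R 1%R; e 3%R 2%R]%N.

Lemma mmap1_view_param (T : comNzRingType) (y : 'M[T]_(4, 3)) m :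
  mmap1 (fun k => mxvec (view_param y) 0 k) m = mmap1 (fun k => mxvec y 0 k) (phi_mnm m).
Proof.
rewrite !mmap1_43 !mxvecE !mxE /= !mnm_seqE /=.
generalize (m (mxvec_index 0 0)) (m (mxvec_index 0 1)) (m (mxvec_index 0 2)) => e00 e01 e02.
generalize (m (mxvec_index 1 0)) (m (mxvec_index 1 1)) (m (mxvec_index 1 2)) => e10 e11 e12.
generalize (m (mxvec_index 2 0)) (m (mxvec_index 2 1)) (m (mxvec_index 2 2)) => e20 e21 e22.
generalize (m (mxvec_index 3 0)) (m (mxvec_index 3 1)) (m (mxvec_index 3 2)) => e30 e31 e32.
generalize (y 0 0) (y 0 1) (y 0 2) => y00 y01 y02.
generalize (y 1 0) (y 1 1) (y 1 2) => y10 y11 y12.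
generalize (y 2 0) (y 2 1) (y 2 2) => y20 y21 y22.
generalize (y 3 0) (y 3 1) (y 3 2) => y30 y31 y32.
rewrite !exprD !exprMn.
ring.
Qed.

Lemma mmap1_mnm_swap (T : comNzRingType) (y : 'M[T]_(4, 3)) k k' :
  mmap1 (fun i => mxvec y 0 i) (mnm_seq [:: k; 0; 0; 0; k; 0; k'; 0; 0; 0; k'; 0]%N)
  = (y 0 0 * y 1 1) ^+ k * (y 2 0 * y 3 1) ^+ k'.
Proof. by rewrite mmap1_43 !mxvecE !mnm_seqE /= !exprMn; ring. Qed.

Lemma mmap1_mnm_keep (T : comNzRingType) (y : 'M[T]_(4, 3)) k k' :
  mmap1 (fun i => mxvec y 0 i) (mnm_seq [:: 0; k; 0; k; 0; 0; 0; k'; 0; k'; 0; 0]%N)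
  = (y 0 1 * y 1 0) ^+ k * (y 2 1 * y 3 0) ^+ k'.
Proof. by rewrite mmap1_43 !mxvecE !mnm_seqE /= !exprMn; ring. Qed.

Lemma mmap1_mnm_multiset (T : comNzRingType) (y : 'M[T]_(4, 3)) i j :
  (i <= 2)%N -> (j <= 2)%N ->
  mmap1 (fun k => mxvec y 0 k)
    (mnm_seq [:: 2 - i; i; 0; 0; 0; 0; 2 - j; j; 0; 0; 0; 0]%N)
  = y 0 (pick_coord (0 < i)%N) * y 0 (pick_coord (1 < i)%N) *
    (y 2 (pick_coord (0 < j)%N) * y 2 (pick_coord (1 < j)%N)).
Proof.
rewrite mmap1_43 !mxvecE !mnm_seqE /=.
by case: i => [|[|[|?]]] //; case: j => [|[|[|?]]] // _ _; rewrite /= /pick_coord; ring.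
Qed.

Section ParamIdeal.
Variables (K : fieldType) (M : 'M[K]_4).
Local Notation S := {mpoly K[4 * 3]}.
Let x : 'M[S]_(4, 3) := \matrix_(f, j) 'X_(mxvec_index f j).
Let MS : 'M[S]_4 := map_mx (@mpolyC _ K) M.
Let phi : {rmorphism S -> S} := mx_eval (@mpolyC _ K) (view_param x).
Let J := ideal_generated (fun G => exists2 k, k \in [set: 'I_11] & G = rigid_generator MS x k).

(** A preimage under [phi_mnm] amounts, for each world point, to a 2 x 2 table of exponents with
    prescribed row and column sums. The one selected has the largest possible upper left entry; the
    remaining entries are then determined. *)
Definition sec_mnm (n : 'X_{1.. 4 * 3}) : 'X_{1.. 4 * 3} :=
  let e f j := n (mxvec_index f j) in
  let i := minn (e 0 0) (e 1 0) in let j := minn (e 2 0) (e 3 0) in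
  mnm_seq [:: i; e 1%R 0%R - i; e 0%R 2%R; e 0%R 0%R - i; e 1%R 1%R - (e 0%R 0%R - i); e 1%R 2%R;
              j; e 3%R 0%R - j; e 2%R 2%R; e 2%R 0%R - j; e 3%R 1%R - (e 2%R 0%R - j); e 3%R 2%R]%N.

(** For [g] equal to 0 or 2 this is deg_{a,b} - deg_{s,t} in the parameters of X or Y respectively;
    z and w have weight 0. *)
Definition excess_wt (g : 'I_4) : 'M[int]_(4, 3) :=
  \matrix_(f, j) if j == 2 then 0 else (f == g)%:R - (f == g + 1)%:R.

Lemma wt_excess0 m : wt (excess_wt 0) m =
  (m (mxvec_index 0%R 0%R) + m (mxvec_index 0%R 1%R))%N%:Z
  - (m (mxvec_index 1%R 0%R) + m (mxvec_index 1%R 1%R))%N%:Z.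
Proof. by rewrite /wt /= big_ord4 !big_ord3 !mxE /= !mul0rn; lia. Qed.

Lemma wt_excess2 m : wt (excess_wt 2) m =
  (m (mxvec_index 2%R 0%R) + m (mxvec_index 2%R 1%R))%N%:Z
  - (m (mxvec_index 3%R 0%R) + m (mxvec_index 3%R 1%R))%N%:Z.
Proof. by rewrite /wt /= big_ord4 !big_ord3 !mxE /= !mul0rn; lia. Qed.

Definition balanced m := (wt (excess_wt 0) m == 0) && (wt (excess_wt 2) m == 0).

Lemma balanced_phi m : balanced (phi_mnm m).
Proof. by rewrite /balanced wt_excess0 wt_excess2 !mnm_seqE /=; lia. Qed.

Lemma phi_secK m : balanced m -> phi_mnm (sec_mnm m) = m.
Proof.
rewrite /balanced wt_excess0 wt_excess2 => bal; apply: mnm43P.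
by elim/ord4_ind; elim/ord3_ind; rewrite !mnm_seqE /= ?mnm_seqE /=; lia.
Qed.

Lemma monomial_prod (m : 'X_{1.. 4 * 3}) :
  'X_[m] = mmap1 (fun k => mxvec x 0 k) m :> S.
Proof.
rewrite -mmap1_id; apply: mmap1_eq => k.
by case: (mxvec_indexP k) => f j; rewrite mxvecE mxE.
Qed.

Lemma phi_monomial m : phi 'X_[m] = 'X_[phi_mnm m].
Proof.
rewrite [RHS]monomial_prod /phi /= /mx_eval mmapX; exact: mmap1_view_param.
Qed.

Lemma ideal_pow (a b : S) k : J (a - b) -> J (a ^+ k - b ^+ k).
Proof. by move=> Jab; rewrite subrXX mulrC; apply: idealMl. Qed.

(* For views (x, y, z), (x', y', w), the section of the image of a monomial
   replaces min(i', j) factors y x' by x y', i' and j being the exponents of x'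
   and y. *)
Lemma sec_phi_monomial m : J ('X_[sec_mnm (phi_mnm m)] - 'X_[m]).
Proof.
pose e f j := m (mxvec_index f j).
pose k := minn (e 1 0) (e 0 1); pose k' := minn (e 3 0) (e 2 1).
pose m0 := mnm_seq [:: e 0%R 0%R; e 0%R 1%R - k; e 0%R 2%R; e 1%R 0%R - k; e 1%R 1%R; e 1%R 2%R;
   e 2%R 0%R; e 2%R 1%R - k'; e 2%R 2%R; e 3%R 0%R - k'; e 3%R 1%R; e 3%R 2%R]%N.
pose swap := mnm_seq [:: k; 0; 0; 0; k; 0; k'; 0; 0; 0; k'; 0]%N.
pose keep := mnm_seq [:: 0; k; 0; k; 0; 0; 0; k'; 0; k'; 0; 0]%N.
have Em : m = (m0 + keep)%MM.
  by apply: mnm43P; elim/ord4_ind; elim/ord3_ind;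
     rewrite mnmDE !mnm_seqE /= /k /k' /e; lia.
have -> : sec_mnm (phi_mnm m) = (m0 + swap)%MM.
  by apply: mnm43P; elim/ord4_ind; elim/ord3_ind;
     rewrite mnmDE !mnm_seqE /= -!/(e _ _) /k /k'; lia.
rewrite [in X in _ - X]Em.
rewrite !mpolyXD -mulrBr; apply: idealMl.
rewrite !monomial_prod mmap1_mnm_swap mmap1_mnm_keep.
(* Separates the exchange in the first pair of views from that in the second, so that each is
   handled by its own epipolar form. *)
have telescope (c c' d d' : S) : c * c' - d * d' = c' * (c - d) + d * (c' - d').
  by rewrite !mulrBr ![c' * _]mulrC addrA subrK.
rewrite telescope.
apply: idealD; apply: idealMl; apply: ideal_pow; apply: ideal_mem.
  by exists 0; rewrite ?inE.
by exists 1; rewrite ?inE.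
Qed.

Let sigma : {linear S -> S} := mlin (fun m => if balanced m then 'X_[sec_mnm m] : S else 0).

(** Modulo [J], [sigma] is a linear left inverse of [phi]. Membership of [F] in [J] can thus be
    decided on the image [phi F]. *)
Lemma sigma_phi F : J (sigma (phi F) - F).
Proof.
rewrite [F]mpolyE rmorph_sum /= linear_sum -sumrB; apply: ideal_sum => m _.
have -> : phi (F@_m *: 'X_[m]) = F@_m *: phi 'X_[m].
  by rewrite -!mul_mpolyC rmorphM /= mx_evalC.
rewrite linearZ -scalerBr -mul_mpolyC; apply: idealMl.
by rewrite phi_monomial /sigma /= mlinX balanced_phi; apply: sec_phi_monomial.
Qed.

Lemma sigma_unbalanced F :
  (forall m, m \in msupp F -> ~~ balanced m) -> sigma F = 0.
Proof.
move=> unb; rewrite /sigma /= /mlin big_seq big1 // => m mF.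
by rewrite (negbTE (unb m mF)) scaler0.
Qed.

(** All four coordinates sta, stb, tz, sw have excess -1, so mixing them by [M] preserves
    homogeneity; the distance is quadratic in them and has excess 0 in the other group. *)
Lemma whom_param_distance g : (g == 0) || (g == 2) ->
  whom (excess_wt g) (- 2%:R)%R (param_distance MS x).
Proof.
move=> g02.
pose d : int := if g == 0 then -1 else 0; pose d' : int := if g == 0 then 0 else -1.
have WX f j : whom (excess_wt g) (excess_wt g f j) (x f j).
  by rewrite [x _ _]mxE; apply: whomX.
have -> : (- 2%:R)%R = d + d' + (d + d') by rewrite /d /d'; case: ifP.
have WP f h d0 : d0 = excess_wt g h 0 + excess_wt g h 1 + excess_wt g f 0 ->
    d0 = excess_wt g h 0 + excess_wt g h 1 + excess_wt g f 1 ->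
    d0 = excess_wt g h 1 + excess_wt g f 2 ->
    d0 = excess_wt g h 0 + excess_wt g h 2 ->
    forall i, whom (excess_wt g) d0 ((MS *m world_param x f h) i 0).
  move=> E1 E2 E3 E4; apply: whom_lin; elim/ord4_ind; rewrite [world_param _ _ _ _ _]mxE /=.
  - by rewrite E1; apply: whomM (WX _ _); apply: whomM.
  - by rewrite E2; apply: whomM (WX _ _); apply: whomM.
  - by rewrite E3; apply: whomM.
  - by rewrite E4; apply: whomM.
by apply: whom_polar_distance; apply: WP; rewrite !mxE /d /d';
   case/orP: g02 => /eqP->.
Qed.

(** Either the cofactor has excess 2 in both groups, and then the product is the image of a monomial
    times an octic, or every monomial of the product is unbalanced and is killed by [sigma]. *)
Lemma sigma_multiple n : J (sigma (param_distance MS x * 'X_[n])).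
Proof.
have [/andP[/eqP n0 /eqP n2]|unb] :=
  boolP ((wt (excess_wt 0) n == 2) && (wt (excess_wt 2) n == 2)).
  pose e f j := n (mxvec_index f j).
  (* Excess 2 means that [n] has degree at least 2 in a, b. A factor a^(2-i) b^i is split off with
     as many b as possible, and likewise for c, d. *)
  pose i := minn 2 (e 0 1); pose j := minn 2 (e 2 1).
  have lt_k : (2 + i * 3 + j < 11)%N by rewrite /i /j; lia.
  pose c := mnm_seq [:: 2 - i; i; 0; 0; 0; 0; 2 - j; j; 0; 0; 0; 0]%N.
  pose n' := mnm_seq [:: e 0%R 0%R - (2 - i); e 0%R 1%R - i; e 0%R 2%R; e 1%R 0%R; e 1%R 1%R; e 1%R 2%R;
    e 2%R 0%R - (2 - j); e 2%R 1%R - j; e 2%R 2%R; e 3%R 0%R; e 3%R 1%R; e 3%R 2%R]%N.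
  rewrite wt_excess0 in n0; rewrite wt_excess2 in n2.
  have En : n = (c + n')%MM.
    by apply: mnm43P; elim/ord4_ind; elim/ord3_ind;
       rewrite mnmDE !mnm_seqE /= /i /j /e; lia.
  have bal : balanced n'.
    by rewrite /balanced wt_excess0 wt_excess2 !mnm_seqE /= /i /j /e; lia.
  pose G := 'X_[sec_mnm n'] * rigid_generator MS x (Ordinal lt_k).
  have phix : map_mx phi x = view_param x.
    by apply/matrixP => f h; rewrite mxE [x f h]mxE /phi /= mx_evalX.
  have phiM : map_mx phi MS = MS.
    by apply/matrixP => f h; rewrite !mxE /phi /= mx_evalC.
  have EG : param_distance MS x * 'X_[n] = phi G.
    rewrite /G rmorphM phi_monomial phi_secK // rmorph_rigid_generator phix phiM.
    rewrite (@rigid_generator_octic _ _ _ _ i j) ?geq_minl // En mpolyXD.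
    rewrite -mmap1_mnm_multiset ?geq_minl // -monomial_prod.
    by rewrite mulrC -mulrA [RHS]mulrCA.
  rewrite EG -[sigma _](subrK G); apply: idealD; first exact: sigma_phi.
  by apply: idealMl; apply: ideal_mem; exists (Ordinal lt_k); rewrite ?inE.
rewrite sigma_unbalanced; first exact: ideal0.
move=> m; rewrite (perm_mem (msuppMX _ _)) => /mapP[m' m'P ->].
apply: contra unb => /andP[]; rewrite !wtD.
rewrite (whom_param_distance (g := 0) _ m'P) // (whom_param_distance (g := 2) _ m'P) //.
by lia.
Qed.

Lemma param_ideal F G : phi F = param_distance MS x * G -> J F.
Proof.
move=> E; rewrite -[F](subKr (sigma (phi F))); apply: idealD.
  rewrite E [G]mpolyE mulr_sumr linear_sum; apply: ideal_sum => m _.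
  by rewrite -scalerAr linearZ /= -mul_mpolyC; apply: idealMl; apply: sigma_multiple.
by rewrite -mulN1r; apply: idealMl; apply: sigma_phi.
Qed.

End ParamIdeal.

(** * Normal form of a pair of cameras *)

Definition cam_sel (b : bool) (j : 'I_3) : 'I_4 :=
  if j == 2 then (if b then 3 else 2) else lshift 1 j.

(* Writing A2 = B P with P = (A1; row 0 of A2) expresses the rows 1 and 2 of A2,
   modulo row 0, as combinations of the rows of A1: these are the two common
   coordinates of the cameras. *)
Lemma camera_normal_form (K : fieldType) (A1 A2 : 'M[K]_(3, 4)) :
  \det (col_mx A1 (row 0 A2) : 'M_(3 + 1)) != 0 ->
  \det (col_mx A2 (row 2 A1) : 'M_(3 + 1)) != 0 ->
  exists (L : bool -> 'M[K]_3) (H : 'M[K]_4),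
    [/\ forall b, L b \in unitmx, H \in unitmx &
        forall b, L b *m (if b then A2 else A1) = rowsub (cam_sel b) H].
Proof.
set P : 'M_(3 + 1) := col_mx A1 _ => detP detN.
have uP : P \in unitmx by rewrite unitmxE unitfE.
have [B A2E] : exists B : 'M_(3, 3 + 1), A2 = lsubmx B *m A1 + rsubmx B *m row 0 A2.
  by exists (A2 *m invmx P); rewrite -mul_row_col hsubmxK mulmxKV.
pose r i := rsubmx B i 0.
(* The first two rows of [L1 *m A1] and of [L2 *m A2] are the common coordinates, rows 1 and 2 of
   [A2] minus [r] times its row 0. The third is row 2 of [A1], respectively row 0 of [A2]. *)
pose L1 : 'M[K]_3 := \matrix_(i, j) nth 0 [:: lsubmx B 1 j; lsubmx B 2 j; (j == 2)%:R] i.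
pose L2 : 'M[K]_3 := \matrix_(i, j) nth 0
  (nth [::] [:: [:: - r 1; 1; 0]; [:: - r 2; 0; 1]; [:: 1; 0; 0]] i) j.
pose L2' : 'M[K]_3 := \matrix_(i, j) nth 0
  (nth [::] [:: [:: 0; 0; 1]; [:: 1; 0; r 1]; [:: 0; 1; r 2]] i) j.
have L2K : L2' *m L2 = 1%:M.
  apply/matrixP; elim/ord3_ind; elim/ord3_ind; rewrite !mxE big_ord3 !mxE /=; ring.
pose H : 'M[K]_(3 + 1) := col_mx (L1 *m A1) (row 0 A2).
have HE : H = block_mx L1 0 0 1%:M *m P.
  by rewrite /H /P mul_block_col !mul0mx addr0 add0r mul1mx.
have Hu (k : 'I_3) (j : 'I_4) : (H : 'M_4) (lshift 1 k) j = (L1 *m A1) k j := col_mxEu _ _ k j.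
have Hd (j : 'I_4) : (H : 'M_4) (rshift 3 (0 : 'I_1)) j = A2 0 j.
  by rewrite [LHS](col_mxEd (L1 *m A1) (row 0 A2) 0 j) mxE.
have A1E : L1 *m A1 = rowsub (cam_sel false) (H : 'M_4).
  apply/matrixP => i j; rewrite [RHS]mxE.
  have -> : cam_sel false i = lshift 1 i by elim/ord3_ind: i; apply: val_inj.
  by rewrite Hu.
have A2E' : L2 *m A2 = rowsub (cam_sel true) (H : 'M_4).
  apply/matrixP => i j; rewrite [RHS]mxE.
  have A2ij k : A2 k j = (\sum_l lsubmx B k l * A1 l j) + r k * A2 0 j.
    by rewrite {1}A2E /r !mxE big_ord1 !mxE.
  elim/ord3_ind: i.
  - have -> : cam_sel true 0 = lshift 1 (0 : 'I_3) by apply: val_inj.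
    rewrite Hu !mxE !big_ord3 !mxE /= [A2 1 j]A2ij big_ord3 !mxE /=; ring.
  - have -> : cam_sel true 1 = lshift 1 (1 : 'I_3) by apply: val_inj.
    rewrite Hu !mxE !big_ord3 !mxE /= [A2 2 j]A2ij big_ord3 !mxE /=; ring.
  - have -> : cam_sel true 2 = rshift 3 (0 : 'I_1) by apply: val_inj.
    rewrite Hd !mxE !big_ord3 !mxE /=; ring.
have uH : (H : 'M_4) \in unitmx.
  (* The rows of the matrix in the second determinant are combinations of the rows of [H], so [H] is
     invertible; the factorization [HE] then yields the invertibility of [L1]. *)
  have NE : col_mx A2 (row 2 A1) =
    col_mx (L2' *m rowsub (cam_sel true) 1%:M) (row (cam_sel false 2) 1%:M) *m (H : 'M_4).
    rewrite mul_col_mx; congr col_mx.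
      by rewrite -mulmxA mul_rowsub_mx mul1mx -A2E' mulmxA L2K mul1mx.
    rewrite -row_mul mul1mx; apply/rowP => j; rewrite [LHS]mxE [RHS]mxE.
    have -> : cam_sel false 2 = lshift 1 (2 : 'I_3) by apply: val_inj.
    rewrite Hu !mxE big_ord3 !mxE /=; ring.
  have : (col_mx A2 (row 2 A1) : 'M_4) \in unitmx by rewrite unitmxE unitfE.
  by rewrite [X in X \in _]NE unitmx_mul => /andP[].
exists (fun b => if b then L2 else L1), H; split => // -[] //.
  by case/mulmx1_unit: L2K.
move: uH; rewrite HE unitmx_mul => /andP[+ _].
have detb : \det (block_mx L1 0 0 1%:M : 'M_(3 + 1)) = \det L1.
  by rewrite det_ublock det1 mulr1.
by rewrite !unitmxE [X in X \is a _]detb.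
Qed.

Lemma for_generic_pair_normal_form (K : fieldType) (P : 'M[K]_(3, 4) -> 'M[K]_(3, 4) -> Prop) :
  (forall A1 A2 : 'M[K]_(3, 4),
    \det (col_mx A1 (row 0 A2) : 'M_(3 + 1)) != 0 ->
    \det (col_mx A2 (row 2 A1) : 'M_(3 + 1)) != 0 -> P A1 A2) ->
  for_generic_pair P.
Proof.
move=> PA.
pose X : 'M[{mpoly K[(3 + 3) * 4]}]_(3 + 3, 4) := \matrix_(i, j) 'X_(mxvec_index i j).
pose N1 : 'M_(3 + 1) := col_mx (usubmx X) (row 0 (dsubmx X)).
pose N2 : 'M_(3 + 1) := col_mx (dsubmx X) (row 2 (usubmx X)).
have evE (A1 A2 : 'M[K]_(3, 4)) :
    (\det N1 * \det N2).@[fun k => mxvec (col_mx A1 A2) 0 k] =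
    \det (col_mx A1 (row 0 A2) : 'M_(3 + 1)) * \det (col_mx A2 (row 2 A1) : 'M_(3 + 1)).
  pose ev : {rmorphism {mpoly K[(3 + 3) * 4]} -> K} :=
    meval (fun k => mxvec (col_mx A1 A2) 0 k).
  have XE : map_mx ev X = col_mx A1 A2.
    by apply/matrixP => i j; rewrite [LHS]mxE [X i j]mxE /ev /= mevalXU mxvecE.
  have Xu : map_mx ev (usubmx X) = A1 by rewrite map_usubmx XE col_mxKu.
  have Xd : map_mx ev (dsubmx X) = A2 by rewrite map_dsubmx XE col_mxKd.
  by rewrite [LHS](rmorphM ev) -!det_map_mx !map_col_mx !map_row Xu Xd.
exists [:: \det N1 * \det N2]; split; last first.
  move=> A1 A2 nV; apply: PA; apply/eqP => d0; apply: nV => f;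
    by rewrite inE => /eqP->; rewrite evE d0 ?mul0r ?mulr0.
(* With rows e3, e0, e1 here and e0, e1, e2 in [A1], the two determinants are those of the identity
   and of a cyclic permutation matrix [C] with inverse [C']. *)
pose A2 : 'M[K]_(3, 4) := \matrix_(i, j) (j == nth 0 [:: 3; 0; 1] i)%:R.
pose A1 : 'M[K]_(3, 4) := \matrix_(i, j) (j == lshift 1 i)%:R.
exists A1, A2 => /(_ _ (mem_head _ _)); rewrite evE.
pose C : 'M[K]_4 := \matrix_(i, j) (j == nth 0 [:: 3; 0; 1; 2] i)%:R.
pose C' : 'M[K]_4 := \matrix_(i, j) (j == nth 0 [:: 1; 2; 3; 0] i)%:R.
have -> : (col_mx A1 (row 0 A2) : 'M_(3 + 1)) = 1%:M.
  apply/matrixP => i j; rewrite [RHS]mxE; case: (split_ordP i) => k ->.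
    by rewrite col_mxEu mxE eq_sym.
  by rewrite col_mxEd !mxE /= ord1 eq_sym.
have -> : (col_mx A2 (row 2 A1) : 'M_(3 + 1)) = C :> 'M_4.
  apply/matrixP => i j; case: (split_ordP (i : 'I_(3 + 1))) => k ->.
    by rewrite [LHS](col_mxEu A2 (row 2 A1)) !mxE; elim/ord3_ind: k.
  by rewrite [LHS](col_mxEd A2 (row 2 A1)) !mxE ord1.
have CK : C *m C' = 1%:M.
  by apply/matrixP; elim/ord4_ind; elim/ord4_ind; rewrite !mxE big_ord4 !mxE /=; ring.
have : \det C != 0 by case/mulmx1_unit: CK; rewrite unitmxE unitfE.
by rewrite det1 mul1r => /eqP.
Qed.

(** * Views under linear changes of image coordinates and rescaling *)

Section ViewsNormalForm.
Variable T : comNzRingType.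
Implicit Types (p x y : 'M[T]_(4, 3)) (X Y : 'cV[T]_4) (c : 'I_4 -> T).

(** In the order u_1, u_2, v_1, v_2, the parity of [f] gives the camera, and [f < 2] tells views of
    X from views of Y. *)
Definition views (A : bool -> 'M[T]_(3, 4)) X Y : 'M[T]_(4, 3) :=
  \matrix_(f, j) (A (odd f) *m (if (f < 2)%N then X else Y)) j 0.

Definition normal_views X Y : 'M[T]_(4, 3) :=
  \matrix_(f, j) (if (f < 2)%N then X else Y) (cam_sel (odd f) j) 0.

Definition twist (N : bool -> 'M[T]_3) p : 'M[T]_(4, 3) :=
  \matrix_(f, j) \sum_k N (odd f) j k * p f k.

Definition rescale c p : 'M[T]_(4, 3) := \matrix_(f, j) (c f * p f j).

Lemma twistK N N' p : (forall b, N b *m N' b = 1%:M) -> twist N (twist N' p) = p.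
Proof.
move=> NN'; apply/matrixP => f j; rewrite mxE.
transitivity ((N (odd f) *m N' (odd f) *m (row f p)^T) j 0); last first.
  by rewrite NN' mul1mx !mxE.
rewrite -mulmxA mxE; apply: eq_bigr => k _; rewrite !mxE; congr (_ * _).
by apply: eq_bigr => l _; rewrite !mxE.
Qed.

Lemma twist_rescale N c p : twist N (rescale c p) = rescale c (twist N p).
Proof.
apply/matrixP => f j; rewrite !mxE mulr_sumr; apply: eq_bigr => k _.
by rewrite mxE mulrCA.
Qed.

Lemma twist_views A L H X Y :
  (forall b, L b *m A b = rowsub (cam_sel b) H) ->
  twist L (views A X Y) = normal_views (H *m X) (H *m Y).
Proof.
move=> LA; apply/matrixP => f j; rewrite !mxE.
transitivity ((L (odd f) *m A (odd f) *m (if (f < 2)%N then X else Y)) j 0).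
  by rewrite -mulmxA mxE; apply: eq_bigr => k _; rewrite [views _ _ _ _ _]mxE.
by rewrite LA mul_rowsub_mx mxE; case: ifP.
Qed.

End ViewsNormalForm.

Lemma cam_sel_val b :
  [/\ cam_sel b 0 = 0, cam_sel b 1 = 1 & cam_sel b 2 = if b then 3 else 2].
Proof. by split; apply: val_inj. Qed.

Lemma rescale_normal_viewsE (T : comNzRingType) (X Y : 'cV[T]_4) c (f : 'I_4) :
  let x := rescale c (normal_views X Y) in
  let Z := if (f < 2)%N then X else Y in
  [/\ x f 0 = c f * Z 0 0, x f 1 = c f * Z 1 0 &
      x f 2 = c f * Z (if odd f then 3 else 2) 0].
Proof. by move=> x Z; have [E0 E1 E2] := cam_sel_val (odd f); rewrite !mxE E0 E1 E2. Qed.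

(** Triangulating actual views returns a multiple of the world point, so every octic is a multiple
    of the distance, and both epipolar forms cancel. *)
Lemma rigid_generator_normal_views (T : comNzRingType) (M : 'M[T]_4) c X Y k :
  polar_distance (M *m X) (M *m X) (M *m Y) (M *m Y) = 0 ->
  rigid_generator M (rescale c (normal_views X Y)) k = 0.
Proof.
set x := rescale _ _ => d0; have xE f := rescale_normal_viewsE X Y c f.
have {xE} [[a0 b0 c0] [a1 b1 c1] [a2 b2 c2] [a3 b3 c3]] := And4 (xE 0) (xE 1) (xE 2) (xE 3).
have TX b : triangulation x 0 1 (pick_coord b) =
    (c 0 * c 1 * X (if b then 1 else 0) 0) *: X.
  rewrite [in RHS](vec4_entries X) vec4Z /triangulation /x; case: b;
  rewrite /pick_coord ?a0 ?b0 ?c0 ?a1 ?b1 ?c1 /=; congr vec4; rewrite ?mxE /=; ring.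
have TY b : triangulation x 2 3 (pick_coord b) =
    (c 2 * c 3 * Y (if b then 1 else 0) 0) *: Y.
  rewrite [in RHS](vec4_entries Y) vec4Z /triangulation /x; case: b;
  rewrite /pick_coord ?a2 ?b2 ?c2 ?a3 ?b3 ?c3 /=; congr vec4; rewrite ?mxE /=; ring.
rewrite /rigid_generator; case: eqP => _.
  by rewrite /epipolar /x a0 b1 b0 a1 /=; ring.
case: eqP => _; first by rewrite /epipolar /x a2 b3 b2 a3 /=; ring.
by rewrite !TX !TY -!scalemxAr polar_distanceZ d0 mulr0.
Qed.

(** The world point (sta, stb, tz, sw) is seen as t(sa, sb, z) and s(ta, tb, w); the extra factors
    t, s are removed later by cancellation. *)
Lemma normal_views_world (T : comNzRingType) (y : 'M[T]_(4, 3)) :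
  normal_views (world_param y 0 1) (world_param y 2 3) =
  rescale (fun f => nth 0 [:: y 1 1; y 1 0; y 3 1; y 3 0] f) (view_param y).
Proof.
apply/matrixP; elim/ord4_ind; elim/ord3_ind; rewrite !mxE /=; ring.
Qed.

Lemma rmorph_param_distance (T U : comNzRingType) (g : {rmorphism T -> U}) M y :
  g (param_distance M y) = param_distance (map_mx g M) (map_mx g y).
Proof.
by rewrite /param_distance rmorph_polar_distance !map_mxM /world_param !map_vec4
  !rmorphM !mxE.
Qed.

Lemma map_view_param (T U : comNzRingType) (g : {rmorphism T -> U}) y :
  map_mx g (view_param y) = view_param (map_mx g y).
Proof.
by apply/matrixP; elim/ord4_ind; elim/ord3_ind; rewrite !mxE /= ?rmorphM.
Qed.

Lemma polar_distance_sym (T : comNzRingType) (X Y : 'cV[T]_4) :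
  polar_distance X X Y Y = polar_distance Y Y X X.
Proof. by rewrite /polar_distance; ring. Qed.

(** A point at infinity is tested against the origin, where the form is a sum of real squares; a
    finite point is tested against the point at infinity (1, 0, 0, 0), where it is X_3^2. *)
Lemma exists_distance_neq0 (R : realFieldType) (X : 'cV[R]_4) :
  X != 0 -> exists Y, polar_distance X X Y Y != 0.
Proof.
move=> X0; case: (eqVneq (X 3 0) 0) => X3.
  exists (vec4 0 0 0 1); apply: contra X0 => /eqP.
  rewrite /polar_distance !mxE /= X3 !(mul0r, mulr0, mulr1, subr0) -!expr2.
  move/eqP; rewrite !paddr_eq0 ?addr_ge0 ?sqr_ge0 // !sqrf_eq0.
  case/andP => /andP[/eqP x0 /eqP x1] /eqP x2.
  by apply/eqP; rewrite (vec4_entries X) x0 x1 x2 X3; apply/colP; elim/ord4_ind; rewrite !mxE.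
exists (vec4 1 0 0 0).
rewrite /polar_distance !mxE /= !(mul0r, mulr0, mul1r, sub0r, subr0, mulrNN, addr0).
by rewrite mulf_neq0.
Qed.

(** The listed entries are a, s, t and their counterparts for Y, the variables to be cancelled: none
    of them divides the distance. *)
Lemma param_distance_neq0 (R : realFieldType) (M : 'M[R]_4) f0 j0 :
  M \in unitmx ->
  (f0, j0) \in ([:: (0, 0); (1, 0); (1, 1); (2, 0); (3, 0); (3, 1)] : seq ('I_4 * 'I_3)) ->
  exists y : 'M[R]_(4, 3), y f0 j0 = 0 /\ param_distance M y != 0.
Proof.
move=> uM fj.
have Minj (X : 'cV[R]_4) : X != 0 -> M *m X != 0.
  by apply: contra => /eqP E; rewrite -[X](mulKmx uM) E mulmx0.
(* With one of a, s, t zero and all other parameters 1, the world point still has z- or w-coordinate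
   1. *)
pose y0 : 'M[R]_(4, 3) := \matrix_(f, j) (((f, j) != (f0, j0)))%:R.
pose g : 'I_4 := if (f0 < 2)%N then 0 else 2.
pose h : 'I_4 := if (f0 < 2)%N then 1 else 3.
have W0 : world_param y0 g h != 0.
  rewrite /g /h /y0; move: fj; rewrite !inE.
  move=> /orP[|/orP[|/orP[|/orP[|/orP[]]]]] /eqP[-> ->];
  by apply/eqP => /colP E; move: (E 2) (E 3); rewrite !mxE /= ?mulr1 => /eqP + /eqP;
     rewrite ?oner_eq0.
have [Y dY] := exists_distance_neq0 (Minj _ W0).
pose Z := invmx M *m Y.
(* The other world point can be prescribed as [Z], by taking 1 for its parameters s and t. *)
pose y : 'M[R]_(4, 3) := \matrix_(f, j)
  if ((f < 2) == (f0 < 2))%N then y0 f j else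
  nth 0 (nth [::] [:: [:: Z 0 0; Z 1 0; Z 2 0]; [:: 1; 1; Z 3 0]] (odd f)) j.
exists y; split; first by rewrite !mxE !eqxx.
rewrite /param_distance.
have W01 : world_param y 0 1 = if (f0 < 2)%N then world_param y0 g h else Z.
  rewrite [in RHS](vec4_entries Z) /world_param /g /h /y !mxE.
  by case: (f0 < 2)%N => //=; rewrite !mul1r.
have W23 : world_param y 2 3 = if (f0 < 2)%N then Z else world_param y0 g h.
  rewrite [in RHS](vec4_entries Z) /world_param /g /h /y !mxE.
  by case: (f0 < 2)%N => //=; rewrite !mul1r.
rewrite W01 W23; move: dY; rewrite -[Y](mulKVmx uM) -/Z.
by case: (f0 < 2)%N => //= dY; rewrite polar_distance_sym.
Qed.

(** * Generators for arbitrary cameras *)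

Definition coords (K : comNzRingType) : 'M[{mpoly K[4 * 3]}]_(4, 3) :=
  \matrix_(f, j) 'X_(mxvec_index f j).

Lemma map_mx_eval_coords (K T : comNzRingType) (f : {rmorphism K -> T}) p :
  map_mx (mx_eval f p) (coords K) = p.
Proof. by apply/matrixP => i j; rewrite mxE [coords K i j]mxE mx_evalX. Qed.

Lemma map_mx_eval_const (K T : comNzRingType) (f : {rmorphism K -> T}) p
    m n (N : 'M[K]_(m, n)) :
  map_mx (mx_eval f p) (map_mx (@mpolyC _ K) N) = map_mx f N.
Proof. by apply/matrixP => i j; rewrite !mxE mx_evalC. Qed.

Lemma mx_eval_coords (K : comNzRingType) (F : {mpoly K[4 * 3]}) :
  mx_eval (@mpolyC _ K) (coords K) F = F.
Proof.
rewrite -[RHS]mmap_id; apply: eq_mmap => k.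
by case: (mxvec_indexP k) => f j; rewrite mxvecE mxE.
Qed.

Lemma map_twist (T U : comNzRingType) (g : {rmorphism T -> U}) N p :
  map_mx g (twist N p) = twist (fun b => map_mx g (N b)) (map_mx g p).
Proof.
apply/matrixP => f j; rewrite !mxE rmorph_sum; apply: eq_bigr => k _.
by rewrite rmorphM !mxE.
Qed.

Lemma map_views (T U : comNzRingType) (g : {rmorphism T -> U}) A X Y :
  map_mx g (views A X Y) = views (fun b => map_mx g (A b)) (map_mx g X) (map_mx g Y).
Proof.
apply/matrixP => f j; rewrite !mxE rmorph_sum; apply: eq_bigr => k _.
by rewrite rmorphM !mxE; case: ifP; rewrite !mxE.
Qed.

Lemma eq_twist (T : comNzRingType) (N N' : bool -> 'M[T]_3) p :
  N =1 N' -> twist N p = twist N' p.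
Proof.
by move=> NN'; apply/matrixP => f j; rewrite !mxE; apply: eq_bigr => k _; rewrite NN'.
Qed.

Lemma twist0 (T : comNzRingType) (N : bool -> 'M[T]_3) : twist N 0 = 0.
Proof. by apply/matrixP => f j; rewrite !mxE big1 // => k _; rewrite mxE mulr0. Qed.

Section RigidIdeal.
Variables (R : realType) (A : bool -> 'M[R]_(3, 4)) (L : bool -> 'M[R]_3) (H : 'M[R]_4).
Hypothesis uL : forall b, L b \in unitmx.
Hypothesis uH : H \in unitmx.
Hypothesis LA : forall b, L b *m A b = rowsub (cam_sel b) H.

Local Notation S := {mpoly R[4 * 3]}.
Let toC : {rmorphism R -> R[i]%C} := real_complex R.
Let x : 'M[S]_(4, 3) := coords R.
Let lift m n (N : 'M[R]_(m, n)) : 'M[S]_(m, n) := map_mx (@mpolyC _ R) N.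
Let MS : 'M[S]_4 := lift (invmx H).
Let LS b : 'M[S]_3 := lift (L b).
Let LiS b : 'M[S]_3 := lift (invmx (L b)).

(** The normal form generators pulled back along the image coordinate changes [L], with the distance
    taken after undoing the world coordinate change [H]. *)
Definition camera_generator (k : 'I_11) : S := rigid_generator MS (twist LS x) k.

Let LSK b : LS b *m LiS b = 1%:M.
Proof. by rewrite /LS /LiS /lift -map_mxM mulmxV // map_mx1. Qed.

Let LiSK b : LiS b *m LS b = 1%:M.
Proof. by rewrite /LS /LiS /lift -map_mxM mulVmx // map_mx1. Qed.

Lemma camera_generator_homogeneous k :
  multihomogeneous_of_degree
    (if nat_of_ord k == 0%N then [tuple 1%N; 1%N; 0%N; 0%N]
     else if nat_of_ord k == 1%N then [tuple 0%N; 0%N; 1%N; 1%N]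
     else [tuple 2%N; 2%N; 2%N; 2%N]) (camera_generator k).
Proof.
apply/multihomogeneous_of_degreeP => f.
pose dl (h : 'I_4) : int := (h == f)%:R.
have Wl h j : whom (factor_wt f) (dl h) (twist LS x h j).
  rewrite mxE; apply: whom_sum => l _; rewrite mxE -[dl h]add0r.
  apply: whomM; first exact: whomC.
  by have := @whomX R (factor_wt f) h l; rewrite [factor_wt f h l]mxE [x h l]mxE.
have Wt h h' b i :
    whom (factor_wt f) (dl h + dl h') ((MS *m triangulation (twist LS x) h h' b) i 0).
  apply: whom_lin; elim/ord4_ind; rewrite [triangulation _ _ _ _ _ _]mxE; exact: whomM.
have We h h' : whom (factor_wt f) (dl h + dl h') (epipolar (twist LS x) h h').
  by apply: whomB; apply: whomM.
rewrite /camera_generator /rigid_generator; case: eqP => _.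
  have -> : (tnth [tuple 1; 1; 0; 0] f)%N%:Z = dl 0 + dl 1
    by rewrite /dl; elim/ord4_ind: f {dl Wl Wt We}.
  exact: We.
case: eqP => _.
  have -> : (tnth [tuple 0; 0; 1; 1] f)%N%:Z = dl 2 + dl 3
    by rewrite /dl; elim/ord4_ind: f {dl Wl Wt We}.
  exact: We.
have -> : (tnth [tuple 2; 2; 2; 2] f)%N%:Z =
    dl 0 + dl 1 + (dl 2 + dl 3) + (dl 0 + dl 1 + (dl 2 + dl 3)).
  by rewrite /dl; elim/ord4_ind: f {dl Wl Wt We}.
exact: whom_polar_distance.
Qed.

Lemma eval_camera_generator (T : comNzRingType) (f : {rmorphism R -> T}) p k :
  mx_eval f p (camera_generator k) =
  rigid_generator (map_mx f (invmx H)) (twist (fun b => map_mx f (L b)) p) k.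
Proof.
rewrite rmorph_rigid_generator /MS map_mx_eval_const map_twist map_mx_eval_coords.
rewrite (@eq_twist _ _ (fun b => map_mx f (L b))) // => b.
exact: map_mx_eval_const.
Qed.

Let LAT (T : comNzRingType) (f : {rmorphism R -> T}) b :
  map_mx f (L b) *m map_mx f (A b) = rowsub (cam_sel b) (map_mx f H).
Proof. by rewrite -map_mxM LA map_mxsub. Qed.

Let variety := rigid_multiview_variety (map_mx toC (A false)) (map_mx toC (A true)).

Lemma camera_generator_vanishes k p :
  variety p -> eval_at (map_mpoly toC (camera_generator k)) p = 0.
Proof.
case=> _; apply.
  eexists => m; rewrite (perm_mem (msupp_map_mpoly _ _)); last exact: fmorph_inj.
  exact: camera_generator_homogeneous.
move=> q [X [Y [c [[X0 Y0 dXY] _ _ qE]]]].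
rewrite eval_at_map eval_camera_generator.
have -> : q = rescale c (views (fun b => map_mx toC (A b)) X Y).
  apply/matrixP => f j; have /rowP/(_ j) := qE f; rewrite [LHS]mxE => ->.
  rewrite !mxE; congr (_ * _); move: f {qE}.
  by elim/ord4_ind; rewrite (tnth_nth 0) /= ?mxE.
rewrite twist_rescale (twist_views _ _ (LAT toC)).
apply: rigid_generator_normal_views.
by rewrite !mulmxA -map_mxM mulVmx // map_mx1 !mul1mx polar_distance_diag.
Qed.

(** Both cameras see coordinate 0 of [H *m X] and [H *m Y]; when it is nonzero, no view vanishes and
    the rational map is defined. *)
Lemma views_in_variety (X Y : 'cV[R[i]%C]_4) :
  polar_distance X X Y Y = 0 ->
  (map_mx toC H *m X) 0 0 != 0 -> (map_mx toC H *m Y) 0 0 != 0 ->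
  variety (views (fun b => map_mx toC (A b)) X Y).
Proof.
move=> d0 hX hY; set p := views _ X Y.
have neq0 (Z : 'cV_4) : (map_mx toC H *m Z) 0 0 != 0 ->
    Z != 0 /\ forall b, map_mx toC (A b) *m Z != 0.
  move=> hZ; split=> [|b]; first by apply: contra hZ => /eqP->; rewrite mulmx0 mxE.
  apply: contra hZ => /eqP AZ.
  have := LAT toC b; move/(congr1 (fun N : 'M_(3, 4) => (N *m Z) 0 0)).
  rewrite -mulmxA AZ mulmx0 mxE mul_rowsub_mx mxE.
  by have [-> _ _] := cam_sel_val b => <-.
have [X0 AX] := neq0 _ hX; have [Y0 AY] := neq0 _ hY.
have rowp f : row f p = (map_mx toC (A (odd f)) *m (if (f < 2)%N then X else Y))^T.
  by apply/rowP => j; rewrite !mxE.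
have im : rigid_image (map_mx toC (A false)) (map_mx toC (A true)) p.
  exists X, Y, (fun=> 1); split=> //.
  - by move=> f; elim/ord4_ind: f; rewrite (tnth_nth 0) /=.
  - by move=> f; rewrite oner_eq0.
  - by move=> f; rewrite scale1r rowp; elim/ord4_ind: f; rewrite (tnth_nth 0) /=.
split=> [f|F _]; last exact.
rewrite rowp -[0]trmx0 (inj_eq trmx_inj).
by case: ifP.
Qed.



Lemma kill_param_distance f j :
  (f, j) \in ([:: (0, 0); (1, 0); (1, 1); (2, 0); (3, 0); (3, 1)] : seq ('I_4 * 'I_3)) ->
  kill_var (mxvec_index f j) (param_distance MS x) != 0.
Proof.
move=> fj; have uM : invmx H \in unitmx by rewrite unitmx_inv.
have [y [y0 dy]] := param_distance_neq0 uM fj.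
apply: contra dy => /eqP /(congr1 (mx_eval idfun y)).
rewrite rmorph0 /mx_eval mmap_kill_var.
rewrite (@eq_mmap _ _ _ _ _ (fun k => mxvec y 0 k)) => [|k]; last first.
  case: eqP => [->|//]; by rewrite mxvecE y0.
rewrite -/(mx_eval idfun y _) rmorph_param_distance map_mx_eval_coords map_mx_eval_const.
have -> : map_mx idfun (invmx H) = invmx H by apply/matrixP => ? ?; rewrite mxE.
by move=> ->.
Qed.

(** Divisibility by Q holds in world coordinates by [distance_dvd]. Substituting the parametrized
    world points turns it into divisibility by [param_distance], up to powers of six variables. *)
Lemma view_param_dvd d F :
  multihomogeneous_of_degree d F ->
  (forall p, variety p -> eval_at (map_mpoly toC F) p = 0) ->
  exists G, mx_eval (@mpolyC _ R) (twist LiS (view_param x)) F = param_distance MS x * G.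
Proof.
move=> hF F0.
pose X : 'cV[{mpoly R[4 + 4]}]_4 := \col_i 'X_(lshift 4 i).
pose Y : 'cV[{mpoly R[4 + 4]}]_4 := \col_i 'X_(rshift 4 i).
pose cst m n (N : 'M[R]_(m, n)) := map_mx (@mpolyC (4 + 4) R) N.
(* The extra factors make [q] vanish also at the zeros of Q where [views_in_variety] does not
   apply. *)
pose q := mx_eval (@mpolyC (4 + 4) R) (views (fun b => cst _ _ (A b)) X Y) F *
  ((cst _ _ H *m X) 0 0 * (cst _ _ H *m Y) 0 0).
have evXY (T : comNzRingType) (f : {rmorphism R -> T}) (X' Y' : 'cV[T]_4) :
    let ev : {rmorphism _ -> T} := mmap f (fun k => col_mx X' Y' k 0) in
    map_mx ev X = X' /\ map_mx ev Y = Y'.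
  by split; apply/colP => i; rewrite !mxE /= mmapX mmap1U ?col_mxEu ?col_mxEd.
have evc (T : comNzRingType) (f : {rmorphism R -> T}) h m n (N : 'M[R]_(m, n)) :
    map_mx (mmap f h) (cst _ _ N) = map_mx f N.
  by apply/matrixP => i j; rewrite !mxE mmapC.
have evq (T : comNzRingType) (f : {rmorphism R -> T}) (X' Y' : 'cV[T]_4) :
    mmap f (fun k => col_mx X' Y' k 0) q =
    mx_eval f (views (fun b => map_mx f (A b)) X' Y') F *
    ((map_mx f H *m X') 0 0 * (map_mx f H *m Y') 0 0).
  pose ev : {rmorphism _ -> T} := mmap f (fun k => col_mx X' Y' k 0).
  have [eX eY] := evXY T f X' Y'.
  have eH Z : ev ((cst _ _ H *m Z) 0 0) = (map_mx f H *m map_mx ev Z) 0 0.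
    by rewrite -(evc T f (fun k => col_mx X' Y' k 0)) -map_mxM [RHS]mxE.
  rewrite -[LHS]/(ev q) /q !rmorphM !eH eX eY; congr (_ * _).
  rewrite (rmorph_mx_eval (f' := f)) => [|c]; last exact: mmapC.
  rewrite map_views eX eY; congr mx_eval; apply/matrixP => i j; rewrite !mxE.
  by apply: eq_bigr => l _; rewrite [map_mx ev _]evc.
have [X' Y' d0|G qG] := @distance_dvd R q.
  rewrite evq.
  have [->|hX] := eqVneq ((map_mx toC H *m X') 0 0) 0; first by rewrite mul0r mulr0.
  have [->|hY] := eqVneq ((map_mx toC H *m Y') 0 0) 0; first by rewrite !mulr0.
  have := F0 _ (views_in_variety d0 hX hY).
  by rewrite eval_at_map => ->; rewrite mul0r.
pose w01 := world_param x 0 1; pose w23 := world_param x 2 3.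
pose sub : {rmorphism _ -> S} :=
  mmap (@mpolyC _ R) (fun k => col_mx (MS *m w01) (MS *m w23) k 0).
have HMS (w : 'cV[S]_4) : map_mx (@mpolyC _ R) H *m (MS *m w) = w.
  by rewrite mulmxA /MS /lift -map_mxM mulmxV // map_mx1 mul1mx.
have [eX eY] := evXY S (@mpolyC _ R) (MS *m w01) (MS *m w23).
have subQ : sub (polar_distance X X Y Y) = param_distance MS x.
  by rewrite rmorph_polar_distance eX eY.
have : sub q = param_distance MS x * sub G by rewrite -subQ -rmorphM -qG.
have -> : sub q =
    mx_eval (@mpolyC _ R)
      (views (fun b => map_mx (@mpolyC _ R) (A b)) (MS *m w01) (MS *m w23)) F *
    (w01 0 0 * w23 0 0).
  rewrite [LHS](evq S (@mpolyC _ R) (MS *m w01) (MS *m w23)).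
  by congr (_ * (_ * _)); rewrite HMS.
pose c (f : 'I_4) := nth 0 [:: x 1 1; x 1 0; x 3 1; x 3 0] f.
have -> : views (fun b => map_mx (@mpolyC _ R) (A b)) (MS *m w01) (MS *m w23) =
    rescale c (twist LiS (view_param x)).
  rewrite -twist_rescale /c -normal_views_world.
  set V := views _ _ _; rewrite -[V](twistK (N := LiS) (N' := LS)) //; congr twist.
  transitivity (normal_views (map_mx (@mpolyC _ R) H *m (MS *m w01))
                             (map_mx (@mpolyC _ R) H *m (MS *m w23))).
    exact: (twist_views _ _ (LAT (@mpolyC _ R))).
  by congr normal_views; apply: HMS.
rewrite (mx_eval_scale _ _ _ hF) big_ord4 /=.
set P := mx_eval _ _ F; set G' := sub G.
(* Collects the factors produced by homogeneity and by the first world coordinates sta and its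
   analogue, each variable as one power ready for cancellation. *)
have rearrange (T : comNzRingType) (a b c' d' e f P' : T) n1 n2 n3 n4 :
  a ^+ n1 * (b ^+ n2 * (c' ^+ n3 * d' ^+ n4)) * P' * (b * a * e * (d' * c' * f)) =
  a ^+ n1.+1 * (b ^+ n2.+1 * (c' ^+ n3.+1 * (d' ^+ n4.+1 * (e ^+ 1 * (f ^+ 1 * P'))))).
  by rewrite !exprS; ring.
have xE f j : x f j = 'X_(mxvec_index f j) by rewrite mxE.
have -> : w01 0 0 = x 1 0 * x 1 1 * x 0 0 by rewrite [LHS]mxE.
have -> : w23 0 0 = x 3 0 * x 3 1 * x 2 0 by rewrite [LHS]mxE.
rewrite /c /= rearrange !xE.
do 6!move/(cancel_var_dvd (kill_param_distance _)) => {}/(_ isT) [? ]; move=> E.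
by eexists; exact: E.
Qed.

(** Passing to normal form coordinates by [invmx (L b)] makes [param_ideal] applicable; the inverse
    substitution [back] carries its generators to the camera generators. *)
Lemma vanishing_in_ideal F :
  multihomogeneous F ->
  (forall p, variety p -> eval_at (map_mpoly toC F) p = 0) ->
  ideal_generated (fun G => exists2 k, k \in [set: 'I_11] & G = camera_generator k) F.
Proof.
move=> [d hF] F0; have [G EG] := view_param_dvd hF F0.
pose normal := mx_eval (@mpolyC _ R) (twist LiS x) F.
have normalE : mx_eval (@mpolyC _ R) (view_param x) normal = param_distance MS x * G.
  rewrite -EG /normal mx_eval_comp map_twist map_mx_eval_coords.
  rewrite (@eq_twist _ _ LiS) // => b; exact: map_mx_eval_const.
have := param_ideal normalE.
pose back : {rmorphism S -> S} := mx_eval (@mpolyC _ R) (twist LS x).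
have <- : back normal = F.
  rewrite /back /= /normal mx_eval_comp map_twist map_mx_eval_coords.
  rewrite (@eq_twist _ _ LiS) => [|b]; last exact: map_mx_eval_const.
  by rewrite twistK // mx_eval_coords.
apply: ideal_rmorph => _ [k _ ->]; apply: ideal_mem; exists k => //.
rewrite rmorph_rigid_generator map_mx_eval_const map_mx_eval_coords.
by [].
Qed.

End RigidIdeal.

(** * Minimality *)

Definition multiset_mnm (k : 'I_11) : 'X_{1.. 4 * 3} :=
  let i := ((k - 2) %/ 3)%N in let j := ((k - 2) %% 3)%N in
  mnm_seq [:: 2 - i; i; 0; 0; 0; 0; 2 - j; j; 0; 0; 0; 0]%N.

Lemma multiset_mnm_inj (k k' : 'I_11) :
  (1 < k)%N -> (1 < k')%N -> multiset_mnm k = multiset_mnm k' -> k = k'.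
Proof.
move=> k1 k1' E; apply: val_inj => /=.
have := congr1 (fun m : 'X_{1.. 4 * 3} => m (mxvec_index 0 1)) E.
have := congr1 (fun m : 'X_{1.. 4 * 3} => m (mxvec_index 2 1)) E.
rewrite !mnm_seqE /= => ? ?; lia.
Qed.

Lemma rigid_generator_monomial (K : fieldType) (M : 'M[{mpoly K[4 * 3]}]_4) (k : 'I_11) :
  (1 < k)%N ->
  rigid_generator M (view_param (coords K)) k =
  'X_[multiset_mnm k] * param_distance M (coords K).
Proof.
move=> k1; have lt_k := ltn_ord k.
rewrite (@rigid_generator_octic _ _ _ k ((k - 2) %/ 3) ((k - 2) %% 3)); try lia.
congr (_ * _); rewrite -mmap1_mnm_multiset; try lia.
rewrite -/(multiset_mnm k) -mmap1_id; apply: mmap1_eq => i.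
by case: (mxvec_indexP i) => f j; rewrite mxvecE mxE.
Qed.

(** A vanishing first view makes the triangulated point zero. This isolates the epipolar forms from
    the octics. *)
Lemma rigid_generator_half0 (T : comNzRingType) (M : 'M[T]_4) (y : 'M[T]_(4, 3)) (k : 'I_11) :
  (1 < k)%N -> (row 0 y = 0 \/ row 2 y = 0) -> rigid_generator M y k = 0.
Proof.
move=> k1 y0; rewrite /rigid_generator.
case: eqP => [|_]; first by lia.
case: eqP => [|_]; first by lia.
have T0 f g c : row f y = 0 -> triangulation y f g (pick_coord c) = 0.
  move=> /rowP yf; have {}yf j : y f j = 0 by have := yf j; rewrite !mxE.
  by apply/colP; elim/ord4_ind; rewrite !mxE /= ?yf mul0r.
by case: y0 => y0; rewrite !(T0 _ _ _ y0) mulmx0;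
   rewrite /polar_distance /= ![(0 : 'cV_4) _ _]mxE; ring.
Qed.

Section Minimality.
Variables (R : realType) (L : bool -> 'M[R]_3) (H : 'M[R]_4).
Hypothesis uL : forall b, L b \in unitmx.
Local Notation S := {mpoly R[4 * 3]}.
Local Notation gen := (camera_generator L H).
Let x := coords R.

Lemma camera_generator_twist (T : comNzRingType) (f : {rmorphism R -> T}) y k :
  mx_eval f (twist (fun b => map_mx f (invmx (L b))) y) (gen k) =
  rigid_generator (map_mx f (invmx H)) y k.
Proof.
by rewrite eval_camera_generator twistK // => b; rewrite -map_mxM mulmxV // map_mx1.
Qed.

Section MissingIndex.
Variables (D : {set 'I_11}) (k : 'I_11).
Hypothesis kD : k \notin D.
Hypothesis gk : ideal_generated (fun G => exists2 j, j \in D & G = gen j) (gen k).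

Lemma rigid_generator_combination (T : comNzRingType) (f : {rmorphism R -> T}) y :
  (forall j, j != k -> rigid_generator (map_mx f (invmx H)) y j = 0) ->
  rigid_generator (map_mx f (invmx H)) y k = 0.
Proof.
move=> y0; rewrite -camera_generator_twist.
have [n [h [g [gD ->]]]] := gk; rewrite rmorph_sum big1 // => i _.
have [j jD ->] := gD i; rewrite rmorphM /= camera_generator_twist y0 ?mulr0 //.
by apply: contraNneq kD => <-.
Qed.

Lemma missing_not_epipolar : (1 < k)%N.
Proof.
rewrite ltnNge; apply/negP => k1.
have [k0|{}k1] : k = 0%N :> nat \/ k = 1%N :> nat by lia.
  (* With u_1 = e0, u_2 = e1 and v = 0, only the first epipolar form is nonzero; the zero rows are
     harmless, as polynomials are evaluated in affine space. *)
  pose y : 'M[R]_(4, 3) :=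
    \matrix_(f, j) (((f == 0) && (j == 0)) || ((f == 1) && (j == 1)))%:R.
  have : rigid_generator (map_mx idfun (invmx H)) y k = 0.
    apply: rigid_generator_combination => j /eqP jk; have [j1|j1] := ltnP 1 j.
      by apply: rigid_generator_half0 => //; right; apply/rowP => i; rewrite !mxE.
    rewrite /rigid_generator; case: eqP => [j0|j0].
      by case: jk; apply: val_inj; rewrite /= k0.
    case: eqP => [_|j1']; last by exfalso; lia.
    by rewrite /epipolar !mxE /= !mul0r subrr.
  rewrite /rigid_generator k0 /= /epipolar !mxE /= mul1r mul0r subr0.
  by move/eqP; rewrite oner_eq0.
pose y : 'M[R]_(4, 3) :=
  \matrix_(f, j) (((f == 2) && (j == 0)) || ((f == 3) && (j == 1)))%:R.
have : rigid_generator (map_mx idfun (invmx H)) y k = 0.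
  apply: rigid_generator_combination => j /eqP jk; have [j1|j1] := ltnP 1 j.
    by apply: rigid_generator_half0 => //; left; apply/rowP => i; rewrite !mxE.
  rewrite /rigid_generator; case: eqP => [_|j0].
    by rewrite /epipolar !mxE /= !mul0r subrr.
  by case: jk; apply: ord_inj; lia.
rewrite /rigid_generator k1 /= /epipolar !mxE /= mul1r mul0r subr0.
by move/eqP; rewrite oner_eq0.
Qed.

Hypothesis uH : H \in unitmx.

(** The parametrization kills the epipolar forms and turns the octics into distinct monomials times
    the nonzero distance. After cancelling it, a relation with constant coefficients remains to be
    extracted. *)
Lemma missing_not_octic : (k <= 1)%N.
Proof.
rewrite leqNgt; apply/negP => k1.
pose MS : 'M[S]_4 := map_mx (@mpolyC _ R) (invmx H).
pose pd := param_distance MS x.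
have pd0 : pd != 0.
  have := @kill_param_distance R H uH 0 0 isT; apply: contra => /eqP pd0.
  by rewrite -/x -/MS -/pd pd0 rmorph0.
pose LiS b : 'M[S]_3 := map_mx (@mpolyC _ R) (invmx (L b)).
pose th : {rmorphism S -> S} := mx_eval (@mpolyC _ R) (twist LiS (view_param x)).
pose mono (j : 'I_11) : S := if (1 < j)%N then 'X_[multiset_mnm j] else 0.
have thE j : th (gen j) = mono j * pd.
  rewrite [LHS]camera_generator_twist /mono; case: ltnP => j1.
    by rewrite rigid_generator_monomial.
  by rewrite rigid_generator_bilinear // mul0r.
(* Only a, b, c, d survive. The monomials of the octics are unchanged, while all views vanish, so
   every coefficient [th h] reduces to a constant. *)
pose kx : 'M[S]_(4, 3) := \matrix_(f, j) if odd f || (j == 2) then 0 else x f j.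
pose kap : {rmorphism S -> S} := mx_eval (@mpolyC _ R) kx.
have kap_mono j : kap (mono j) = mono j.
  rewrite /mono; case: ltnP => j1; last exact: rmorph0.
  have lt_j := ltn_ord j.
  rewrite /kap /= /mx_eval mmapX /multiset_mnm.
  rewrite mmap1_mnm_multiset; try lia.
  transitivity (mmap1 (fun k => mxvec x 0 k) (multiset_mnm j)); last first.
    rewrite -mmap1_id; apply: mmap1_eq => i.
    by case: (mxvec_indexP i) => f l; rewrite mxvecE mxE.
  rewrite mmap1_mnm_multiset; try lia.
  have kxE b (f : 'I_4) : ~~ odd f -> kx f (pick_coord b) = x f (pick_coord b).
    by move=> /negbTE f2; rewrite [LHS]mxE f2; case: b.
  by rewrite !kxE.
have kap_th h : kap (th h) = (mx_eval idfun 0 h)%:MP.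
  rewrite /kap /th /= mx_eval_comp map_twist map_view_param map_mx_eval_coords.
  have -> : view_param kx = 0.
    by apply/matrixP; elim/ord4_ind; elim/ord3_ind; rewrite !mxE /= ?mul0r ?mulr0.
  rewrite twist0 -(map_mx0 (@mpolyC (4 * 3) R)); symmetry.
  exact: (@rmorph_mx_eval R R idfun _ (@mpolyC (4 * 3) R) (@mpolyC (4 * 3) R) 0 h).
have [n [h [g [gD E]]]] := gk; have [jj jjD gE] := fin_all_exists2 gD.
have {E} : mono k = \sum_(i < n) th (h i) * mono (jj i).
  apply: (mulIf pd0); rewrite -thE E rmorph_sum mulr_suml; apply: eq_bigr => i _.
  by rewrite rmorphM gE [th (gen _)]thE mulrA.
move=> Ek; have : mono k = \sum_(i < n) (mx_eval idfun 0 (h i))%:MP * mono (jj i).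
  rewrite -[LHS]kap_mono Ek [LHS](rmorph_sum kap); apply: eq_bigr => i _.
  by rewrite [LHS](rmorphM kap) -[in RHS]kap_mono; congr (_ * _); apply: kap_th.
move/(congr1 (mcoeff (multiset_mnm k))).
rewrite {1}/mono k1 mcoeffX eqxx raddf_sum big1 => [/eqP|i _] /=.
  by rewrite oner_eq0.
rewrite mcoeffCM /mono; case: ltnP => j1; last by rewrite mcoeff0 mulr0.
rewrite mcoeffX; case: eqP => [/multiset_mnm_inj E|_]; last by rewrite mulr0.
by move: kD; rewrite -E // jjD.
Qed.

End MissingIndex.
End Minimality.

Theorem proposition1 (R : realType) :
  for_generic_pair (fun A1 A2 : 'M[R]_(3, 4) =>
    exists g : 'I_11 -> viewring R,
      minimally_generates g (rigid_multiview_ideal A1 A2) /\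
      forall i : 'I_11,
        multihomogeneous_of_degree
          (if nat_of_ord i == 0%N then [tuple 1%N; 1%N; 0%N; 0%N]
           else if nat_of_ord i == 1%N then [tuple 0%N; 0%N; 1%N; 1%N]
           else [tuple 2%N; 2%N; 2%N; 2%N])
          (g i)).
Proof.
apply: for_generic_pair_normal_form => A1 A2 d1 d2.
have [L [H [uL uH LA]]] := camera_normal_form d1 d2.
exists (camera_generator L H); split; last exact: camera_generator_homogeneous.
have gens k : rigid_multiview_ideal A1 A2 (camera_generator L H k).
  apply: ideal_mem; split; last exact: (camera_generator_vanishes uH LA).
  eexists; exact: camera_generator_homogeneous.
have generated F : rigid_multiview_ideal A1 A2 F <->
    ideal_generated (fun G => exists2 k, k \in [set: 'I_11] & G = camera_generator L H k) F.
  split; last by apply: ideal_sub => _ [k _ ->]; apply: gens.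
  apply: ideal_sub => G [hG G0]; exact: (vanishing_in_ideal uL uH LA hG G0).
split=> [//|D genD]; apply/setP => k; rewrite inE; apply: contraT => kD.
have gk := (genD _).1 (gens k).
have k1 := missing_not_epipolar uL kD gk.
by have := missing_not_octic uL kD gk uH; rewrite leqNgt k1.
Qed.
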